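(* Let $\lambda>0$ and let $$P(\theta_1,\theta_2,\theta_3)=1+p_1\theta_1+p_2\theta_2+p_3\theta_3+p_{12}\theta_1\theta_2+p_{13}\theta_1\theta_3+p_{23}\theta_2\theta_3+p_{123}\theta_1\theta_2\theta_3$$ with $p_i>0$ for $i\in\{1,2,3\}$, $p_{ij}>0$ for $i\ne j$ (where $p_{ij}=p_{ji}$), $p_{123}>0$. Put $\widetilde p_1=-p_{23}/p_{123}$, $\widetilde p_2=-p_{13}/p_{123}$, $\widetilde p_3=-p_{12}/p_{123}$, and assume that $$\widetilde b_{ij}=-\frac{p_k}{p_{123}}+\frac{p_{jk}p_{ik}}{p_{123}^2}\geqslant 0\quad\text{whenever }\{i,j,k\}=\{1,2,3\},$$ $$\widetilde b_{123}=-\frac{1}{p_{123}}+\frac{p_{12}p_3}{p_{123}^2}+\frac{p_{13}p_2}{p_{123}^2}+\frac{p_{23}p_1}{p_{123}^2}-2\frac{p_{12}p_{13}p_{23}}{p_{123}^3}\geqslant 0 .$$ Then the infinitely divisible multivariate gamma distribution $\gamma_{(P,\lambda)}$ associated with $(P,\lambda)$, i.e. the probability distribution on $\mathbb{R}^3$ with Laplace transform $[P(\theta_1,\theta_2,\theta_3)]^{-\lambda}$, is given by $$\gamma_{(P,\lambda)}(d\mathbf x)=\frac{p_{123}^{-\lambda}}{[\Gamma(\lambda)]^3}\exp(\widetilde p_1x_1+\widetilde p_2x_2+\widetilde p_3x_3)(x_1x_2x_3)^{\lambda-1}\,F_{II}\big(\lambda,\lambda,\;\widetilde b_{13}\widetilde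 b_{23}\,x_1x_2x_3^2,\;\widetilde b_{123}x_1x_2x_3,\;\widetilde b_{12}x_1x_2,\;\widetilde b_{13}x_1x_3+\widetilde b_{23}x_2x_3\big)\mathbf 1_{(0,\infty)^3}(\mathbf x)\,d\mathbf x .$$
   Context: The Laplace transform of the distribution of $\mathbf X=(X_1,X_2,X_3)$ is $\mathbb{E}\{\exp[-(\theta_1X_1+\theta_2X_2+\theta_3X_3)]\}$; that it equals a given function means equality for a set of $\boldsymbol\theta$ with non-empty interior. A distribution is infinitely divisible if, for every $t>0$, the $t$-th power of its Laplace transform is again the Laplace transform of a positive measure. $(a)_k$ is the Pochhammer symbol: $(a)_0=1$, $(a)_{k+1}=(a+k)(a)_k$. The function $F_{II}$ is $$F_{II}(\lambda_1,\lambda_2,z_1,z_2,z_3,z_4)=\sum_{m_1,\ldots,m_4=0}^{\infty}\frac{1}{(\lambda_1)_{m_1+m_2+m_3}(\lambda_2)_{2m_1+m_2+m_4}}\frac{z_1^{m_1}}{m_1!}\frac{z_2^{m_2}}{m_2!}\frac{z_3^{m_3}}{m_3!}\frac{z_4^{m_4}}{m_4!}.$$ $\mathbf 1_S$ denotes the indicator function of $S$. *)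

(* Defs.v *)
From HB Require Import structures.
From mathcomp Require Import all_boot all_order all_algebra.
From mathcomp Require Import all_classical all_reals all_analysis.

Set Implicit Arguments.
Unset Strict Implicit.
Unset Printing Implicit Defensive.

Import Order.TTheory GRing.Theory Num.Theory.
Import numFieldNormedType.Exports.

Local Open Scope classical_set_scope.
Local Open Scope ring_scope.

(* A point (x1, x2, x3) of R^3 is a triple, with coordinates x.1.1, x.1.2 and *)
(* x.2. Its type is written R * R * R when only the product topology matters  *)
(* (the variable of a Laplace transform), and mR3 R, convertible to it, when  *)
(* R^3 carries measures, since lebesgue_measure lives on measurableTypeR R.   *)
Notation mR3 R := (measurableTypeR R * measurableTypeR R * measurableTypeR R)%type.

Definition lebesgue3 {R : realType} :=
  (@lebesgue_measure R \x @lebesgue_measure R \x @lebesgue_measure R)%E.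

(* Takes the value +oo where the exponential is not integrable.               *)
Definition laplace3 (R : realType) (mu : {measure set (mR3 R) -> \bar R})
    (th : R * R * R) : \bar R :=
  (\int[mu]_x (expR (- (th.1.1 * x.1.1 + th.1.2 * x.1.2 + th.2 * x.2)))%:E)%E.

(* Equality of the Laplace transform with f on a set of non-empty interior.   *)
(* D is where the formula f has its mathematical meaning; it is needed since  *)
(* powR is total, with a junk value at a negative base.                       *)
Definition has_laplace3 (R : realType)
    (mu : {measure set (mR3 R) -> \bar R})
    (D : set (R * R * R)) (f : R * R * R -> R) : Prop :=
  exists Th : set (R * R * R),
    [/\ Th° !=set0, Th `<=` D &
        forall th, Th th -> laplace3 mu th = (f th)%:E].

Definition infinitely_divisible3 (R : realType)
    (mu : {measure set (mR3 R) -> \bar R}) : Prop :=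
  forall t : R, 0 < t ->
    exists nu : {measure set (mR3 R) -> \bar R},
      has_laplace3 nu [set th | laplace3 mu th \is a fin_num]
        (fun th => fine (laplace3 mu th) `^ t).

Definition mgamma_law (R : realType) (P : R * R * R -> R) (lam : R)
    (mu : probability (mR3 R) R) : Prop :=
  has_laplace3 mu [set th | 0 < P th] (fun th => P th `^ (- lam)).

Definition Gamma_fun (R : realType) (a : R) : R :=
  (\int[lebesgue_measure]_(t in `]0, +oo[) (t `^ (a - 1) * expR (- t)))%R.

Fixpoint pochhammer (R : realType) (a : R) (k : nat) : R :=
  if k is k'.+1 then (a + k'%:R) * pochhammer a k' else 1.

Definition F_II_term (R : realType) (l1 l2 z1 z2 z3 z4 : R)
    (m1 m2 m3 m4 : nat) : R :=
  (pochhammer l1 (m1 + m2 + m3)%N * pochhammer l2 (2 * m1 + m2 + m4)%N)^-1 *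
  (z1 ^+ m1 / m1`!%:R) * (z2 ^+ m2 / m2`!%:R) *
  (z3 ^+ m3 / m3`!%:R) * (z4 ^+ m4 / m4`!%:R).

(* The quadruple series converges absolutely whenever neither l1 nor l2 is a  *)
(* non-positive integer, so it may be summed along cubes.                     *)
Definition F_II (R : realType) (l1 l2 z1 z2 z3 z4 : R) : R :=
  limn (fun N : nat =>
    \sum_(m1 < N) \sum_(m2 < N) \sum_(m3 < N) \sum_(m4 < N)
      F_II_term l1 l2 z1 z2 z3 z4 m1 m2 m3 m4).

(* Main.v *)
(* Put s_i = th_i - q_i with q_i = - p_jk / p_123. Then                       *)
(*   P = p_123 (s1 s2 s3 - b23 s1 - b13 s2 - b12 s3 - b123).                  *)
(* Existence. Integrate the claimed density times exp (- th . x) term by term *)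
(* in the series of F_II (all terms are nonnegative). Integrating in x3 first *)
(* cancels (lam)_(2 m1 + m2 + m4), and the sum over m4 becomes the factor     *)
(* exp ((b13 x1 + b23 x2) / s3), so the integrals in x1 and x2 are again      *)
(* gamma integrals, with rates t1 = s1 - b13 / s3 and t2 = s2 - b23 / s3; the *)
(* remaining triple sum is a negative binomial series with value              *)
(*   p_123^-lam (t1 t2 s3 - b13 b23 / s3 - b123 - b12 s3)^-lam = P^-lam.      *)
(* At th = 0 this says that the total mass is 1, and replacing lam by lam t   *)
(* gives infinite divisibility.                                               *)
(* Uniqueness. A law nu with the prescribed transform on some open set Th in  *)
(* {P > 0} (possibly in another component than 0) is dealt with by analytic   *)
(* continuation along coordinate lines: P is affine in each coordinate, so on *)
(* such a line the transform of nu has the form (A + B th)^-lam, which        *)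
(* determines the moments of the tilted law as those of a gamma law; this     *)
(* propagates the formula to the whole half-line {A + B th > 0}. Along the    *)
(* segment from Th to 0 the transform of nu is bounded, hence P^-lam cannot   *)
(* blow up and the formula reaches 0, and from there the whole orthant. The   *)
(* transform on the orthant determines the integrals of                       *)
(*   exp (- n sum_i exp (n (c_i - x_i))),                                     *)
(* which tend to the measure of the box {x_i > c_i} as n tends to infinity.   *)

Require Import Defs.
From HB Require Import structures.
From mathcomp Require Import all_boot all_order all_algebra.
From mathcomp Require Import all_classical all_reals all_analysis.
From mathcomp Require Import measurable_realfun lebesgue_integral_under.
From mathcomp Require Import ring lra.

Set Implicit Arguments.
Unset Strict Implicit.
Unset Printing Implicit Defensive.

Import Order.TTheory GRing.Theory Num.Theory.
Import numFieldNormedType.Exports.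

Local Open Scope classical_set_scope.
Local Open Scope ring_scope.

(** * Scaling of Lebesgue measure and measures with a density *)

(** Existence. After translation by [q1], [q2], [q3] the polynomial is [p123] times [s1 * s2 * s3 -
    b23 * s1 - b13 * s2 - b12 * s3 - b123], so the sign conditions make its inverse power a series
    with nonnegative coefficients. [F_II] is that series on the side of densities: its monomials are
    absorbed into gamma kernels ([gamma_density_series]), whose transforms are powers of the rates.
    Nonnegativity allows every exchange of sum and integral in [0, +oo]. The sum over [m4] only
    lowers two rates ([plane_series]), and the other three sums form a negative binomial series
    ([triple_negative_binomial]); [laplace_gamma_density] puts them together.
    [gamma_density_laplace] shows that the closed orthant lies in the domain of convergence, because
    [P] is at least 1 there. Since [q] and [b] depend on [P] alone, the law with exponent [lam * t]
    exists as well, which is infinite divisibility.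

    Uniqueness. A competitor is known only through its transform on some set with interior inside {P
    > 0}. Along a coordinate line the transform is a power of an affine function; its derivatives
    are the moments of a tilted law ([momentE]), and equal moments give equal exponential integrals,
    finiteness included ([laplace_same_moments]). Iterating this covers the half-line where the
    affine function is positive ([gamma_line]). A bound on the transform along the segment to the
    origin keeps [P] away from 0, so the formula reaches the origin ([agree_segment]) and then the
    orthant ([has_laplace3_orthant]). The values on the orthant determine the law
    ([laplace3_unique]), because double exponentials approximate indicators of translated
    orthants. *)

Section scaling.
Context {R : realType}.
Notation mu := (@lebesgue_measure R).

Lemma measurable_scale (c : R) :
  measurable_fun setT ( *%R c : measurableTypeR R -> measurableTypeR R).
Proof. by apply: measurable_funM. Qed.

Let pf (c : R) : {measure set (measurableTypeR R) -> \bar R} :=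
  measure_function_pushforward__canonical__measure_function_Measure mu
    (measurable_scale c).

(** Preimages of intervals under multiplication by [c] are shorter by the factor [c]; agreement on
    half-open intervals is enough, by uniqueness of Lebesgue measure. *)
Lemma lebesgue_measure_scale (c : R) (A : set (measurableTypeR R)) : 0 < c ->
  measurable A ->
  (c%:E * pushforward mu ( *%R c : measurableTypeR R -> measurableTypeR R) A)%E
  = mu A.
Proof.
move=> c0 mA.
pose sc : {measure set (measurableTypeR R) -> \bar R} :=
  mscale (NngNum (ltW c0)) (pf c).
change (sc A = mu A).
apply/esym/lebesgue_measure_unique => //= _ [[a b]] _ <-.
rewrite /sc /= /mscale /= /pf /pushforward.
have -> : *%R c @^-1` `]a, b] = `]a / c, b / c]%classic.
  apply/seteqP; split=> x /=; rewrite !in_itv/= ltr_pdivrMr// ler_pdivlMr//;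
  by rewrite mulrC.
rewrite !lebesgue_measure_itv/= !lte_fin ltr_pM2r ?invr_gt0//.
case: ifPn => _; last by rewrite mule0.
by rewrite -!EFinB -EFinM; congr (_%:E); field; rewrite gt_eqF.
Qed.

Lemma ge0_integral_scale (c : R) (f : R -> \bar R) : 0 < c ->
  measurable_fun [set: R] f -> (forall x, 0 <= f x)%E ->
  (\int[mu]_(x in `]0%R, +oo[) f x =
   c%:E * \int[mu]_(x in `]0%R, +oo[) f (c * x)%R)%E.
Proof.
move=> c0 mf f0.
pose sc : {measure set (measurableTypeR R) -> \bar R} :=
  mscale (NngNum (ltW c0)) (pf c).
transitivity (\int[sc]_(x in `]0%R, +oo[) f x)%E.
  apply: eq_measure_integral => //= A mA _.
  exact/esym/lebesgue_measure_scale.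
rewrite ge0_integral_mscale//=; last exact: measurable_funS mf.
congr (_ * _)%E.
rewrite ge0_integral_pushforward//=; last exact: measurable_funS mf.
suff -> : *%R c @^-1` `]0%R, +oo[ = `]0%R, +oo[%classic by [].
by apply/seteqP; split=> x /=; rewrite !in_itv/= !andbT pmulr_rgt0.
Qed.

End scaling.

Section density.
Local Open Scope ereal_scope.
Context d (T : measurableType d) (R : realType).
Variables (mu : {measure set T -> \bar R}) (f : T -> \bar R).
Hypothesis mf : measurable_fun setT f.
Hypothesis f0 : forall x, 0 <= f x.

Lemma density_sigma_additive :
  semi_sigma_additive (fun A => \int[mu]_(x in A) f x).
Proof.
move=> /= F mF tF mUF; apply: cvg_toP.
  apply: ereal_nondecreasing_is_cvgn => m n mn.
  by apply: lee_sum_nneg_natr => // k _ _; exact: integral_ge0.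
by rewrite ge0_integral_bigcup//=; exact: measurable_funTS.
Qed.

Variable nu : {measure set T -> \bar R}.
Hypothesis nuE : forall A, measurable A -> nu A = \int[mu]_(x in A) f x.

Import HBNNSimple.

(** Both sides are monotone limits along simple functions increasing to [g], and for indicators the
    identity is [nuE]. Here [nu] is any measure with density [f], which covers a probability packed
    later. *)
Lemma ge0_integral_density (g : T -> \bar R) :
  measurable_fun setT g -> (forall x, 0 <= g x) ->
  \int[nu]_x g x = \int[mu]_x (g x * f x).
Proof.
move=> mg g0; pose h := nnsfun_approx measurableT mg.
have hg x : (h n x)%:E @[n --> \oo] --> g x by exact: cvg_nnsfun_approx.
have ndh x : {homo (fun n => (h n x)%:E) : a b / (a <= b)%N >-> a <= b}.
  by move=> a b ab; rewrite lee_fin; exact/lefP/nd_nnsfun_approx.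
(* The delicate case is [f x = +oo]: if [g x = 0] every approximant vanishes at [x], and otherwise
   the approximants are eventually positive, so the products are eventually [+oo]. *)
have fhg x : (h n x)%:E * f x @[n --> \oo] --> g x * f x.
  have := hg x; have := f0 x; case: (f x) => [r r0|_|//] hgx.
    exact: cvgeZr.
  have [gx0|gx0] := eqVneq (g x) 0.
    have h0 n : (h n x)%:E = 0.
      apply/eqP; rewrite eq_le; apply/andP; split; last by rewrite lee_fin.
      have /cvg_lim := ereal_nondecreasing_cvgn (ndh x).
      rewrite (cvg_lim _ hgx)// gx0 => /(_ (@ereal_hausdorff R)) ->.
      by apply: ereal_sup_ubound; exists n.
    under eq_fun do rewrite h0 mul0e.
    by rewrite gx0 mul0e; exact: cvg_cst.
  have gp : 0 < g x by rewrite lt0e gx0 g0.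
  rewrite gt0_muley//; apply: cvg_near_cst.
  have : \forall n \near \oo, 0 < (h n x)%:E.
    case: (g x) gp hgx => [r|_|//].
      rewrite lte_fin => r0 /fine_cvgP[_ /cvgr_gt/(_ _ r0)] /=.
      by apply: filterS => n; rewrite lte_fin.
    by move=> /cvgey_gt; apply.
  by apply: filterS => n hn; rewrite gt0_muley.
transitivity (limn (fun n => \int[nu]_x (h n x)%:E)).
  rewrite -monotone_convergence//.
  - by apply: eq_integral => x _; apply/esym/cvg_lim => //.
  - by move=> n; apply/measurable_EFinP.
  - by move=> n x _; rewrite lee_fin.
transitivity (limn (fun n => \int[mu]_x ((h n x)%:E * f x))); last first.
  rewrite -monotone_convergence//.
  - by apply: eq_integral => x _; apply/cvg_lim => //.
  - by move=> n; apply: emeasurable_funM => //; apply/measurable_EFinP.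
  - by move=> n x _; rewrite mule_ge0// lee_fin.
  - by move=> x _ a b ab; rewrite lee_wpmul2r// ndh.
congr (limn _); apply/funext => n.
under eq_integral do rewrite fimfunE -fsumEFin//.
rewrite ge0_integral_fsum//; last 2 first.
  - by move=> y; exact/measurable_EFinP/measurable_funM.
  - by move=> y x _; rewrite nnfun_muleindic_ge0.
under [RHS]eq_integral => x _.
  rewrite fimfunE -fsumEFin// ge0_mule_fsuml; last first.
    by move=> y; exact: nnfun_muleindic_ge0.
  over.
rewrite ge0_integral_fsum//; last 2 first.
  - by move=> y; apply: emeasurable_funM => //;
      exact/measurable_EFinP/measurable_funM.
  - by move=> y x _; rewrite mule_ge0// nnfun_muleindic_ge0.
apply: eq_fsbigr => r /[!inE] -[x _ hxr].
have r0 : (0 <= r)%R by rewrite -hxr.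
rewrite integralZl_indic_nnsfun// integral_indic// setIT nuE//.
under [RHS]eq_integral do rewrite EFinM -muleA.
rewrite ge0_integralZl//.
- congr (_ * _); rewrite integral_mkcond; apply: eq_integral => t _.
  by rewrite epatch_indic muleC.
- by apply: emeasurable_funM => //; exact/measurable_EFinP.
- by move=> t _; rewrite mule_ge0// lee_fin.
Qed.

End density.

(** * Gamma integrals *)

Section gamma_integral.
Context {R : realType}.
Notation mu := (@lebesgue_measure R).
Implicit Types a s x : R.

Let gam (a : R) (x : R) : R := x `^ (a - 1) * expR (- x).

Lemma measurable_gamma_integrand a s :
  measurable_fun setT (fun x => x `^ (a - 1) * expR (- (s * x))).
Proof.
apply: measurable_funM; first exact: measurable_powR.
apply: measurableT_comp => //; apply: measurable_funN => //.
Qed.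

Let measurable_gam a : measurable_fun setT (gam a).
Proof.
have := measurable_gamma_integrand a 1.
by rewrite /gam; under eq_fun do rewrite mul1r.
Qed.

Let gam_ge0 a x : 0 <= gam a x.
Proof. by rewrite mulr_ge0 ?powR_ge0 ?expR_ge0. Qed.

(** The function x^b e^-x is largest at [x = b]; after taking logarithms this is ln y <= y - 1 at y
    = x / b. *)
Lemma powR_expR_le (b x : R) : 0 < b -> 0 < x ->
  x `^ b * expR (- x) <= b `^ b * expR (- b).
Proof.
move=> b0 x0; rewrite /powR !gt_eqF// -!expRD ler_expR.
have xb : 0 < x / b by rewrite divr_gt0.
have h : ln x - ln b <= x / b - 1.
  rewrite -ln_div ?posrE// -[X in ln X](subrKC 1) le_ln1Dx// ltrBrDr addNr//.
have : b * (ln x - ln b) <= b * (x / b - 1) by rewrite ler_pM2l.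
rewrite [b * (x / b - 1)](_ : _ = x - b); last by field; rewrite gt_eqF.
by rewrite mulrBr; lra.
Qed.

Lemma gamma_integral_finite a : 0 < a ->
  (\int[mu]_(x in `]0%R, +oo[) (x `^ (a - 1) * expR (- x))%:E < +oo)%E.
Proof.
move=> a0.
(* The integrand is dominated by a multiple of f = F', and F is bounded. *)
pose F x := - (1 + x `^ a)^-1.
pose f x := a * x `^ (a - 1) / (1 + x `^ a) ^+ 2.
(* With y = x^a, one has (1 + y)^2 <= 2 + 2 y^2, and y^2 e^-x is bounded by [powR_expR_le] at the
   exponent [a + a]; the division by [a] cancels the factor [a] of [f]. *)
pose C := (2 + 2 * ((a + a) `^ (a + a) * expR (- (a + a)))) / a.
have C0 : 0 <= C.
  by rewrite divr_ge0 ?(ltW a0)// addr_ge0// mulr_ge0// mulr_ge0 ?powR_ge0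
    ?expR_ge0.
have pos x : 0 < 1 + x `^ a by rewrite ltr_wpDr ?powR_ge0.
have f0 x : 0 <= f x.
  by rewrite divr_ge0 ?mulr_ge0 ?powR_ge0 ?exprn_ge0 ?ltW.
have gf x : 0 < x -> gam a x <= C * f x.
  move=> x0; rewrite /gam /C /f.
  rewrite [leRHS](_ : _ = x `^ (a - 1) *
    ((2 + 2 * ((a + a) `^ (a + a) * expR (- (a + a)))) / (1 + x `^ a) ^+ 2));
      last first.
    by field; rewrite !gt_eqF.
  rewrite ler_pM2l ?powR_gt0// ler_pdivlMr ?exprn_gt0//.
  have := @powR_expR_le (a + a) x (addr_gt0 a0 a0) x0.
  rewrite powRD; last by rewrite (gt_eqF x0) implybT.
  set y := x `^ a; set e := expR _; set c := _ * expR _ => yc.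
  have e1 : e <= 1 by rewrite expR_le1 oppr_le0 ltW.
  have e0 : 0 <= e by exact: expR_ge0.
  have : 0 <= e * (1 - y) ^+ 2 by rewrite mulr_ge0// sqr_ge0.
  by lra.
have mg : measurable_fun setT (gam a) := measurable_gam a.
pose D n : set (measurableTypeR R) := `[(n.+1%:R)^-1, n.+1%:R]%classic.
have DU : \bigcup_n D n = `]0, +oo[%classic.
  apply/seteqP; split => x /=.
    move=> [n _]; rewrite /D/= !in_itv/= andbT => /andP[+ _].
    by apply: lt_le_trans; rewrite invr_gt0.
  rewrite in_itv/= andbT => x0.
  exists (Num.truncn (x + x^-1)) => //; rewrite /D/= in_itv/=.
  have := truncnS_gt (x + x^-1); set n := (Num.truncn _).+1 => h.
  have xV0 : 0 < x^-1 by rewrite invr_gt0.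
  apply/andP; split.
    by rewrite invf_ple ?posrE// ltW// (le_lt_trans _ h)// lerDr ltW.
  by rewrite ltW// (le_lt_trans _ h)// lerDl ltW.
have := @ge0_nondecreasing_set_cvg_integral _ (measurableTypeR R) R D
  (EFin \o gam a) mu.
rewrite DU => cvgD.
suff : (\int[mu]_(x in `]0%R, +oo[) (gam a x)%:E <= C%:E)%E.
  by move=> /le_lt_trans; apply; rewrite ltry.
have cvgDn : (\int[mu]_(x in D i) (gam a x)%:E)%E @[i --> \oo] -->
    (\int[mu]_(x in `]0%R, +oo[) (gam a x)%:E)%E.
  apply: cvgD => //.
  - move=> n m nm; apply/subsetPset => x;
    rewrite /D/= !in_itv/= => /andP[h1 h2].
    rewrite (le_trans h2) ?ler_nat// andbT (le_trans _ h1)//.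
    by rewrite lef_pV2 ?posrE// ler_nat.
  - by move=> n; exact: measurable_itv.
  - by move=> n; exact/measurable_EFinP/measurable_funTS.
  - by move=> n x _; rewrite lee_fin.
rewrite -(cvg_lim _ cvgDn)//; apply: lime_le.
  by apply/cvg_ex; eexists; exact: cvgDn.
apply: nearW => n.
have Dpos x : D n x -> 0 < x.
  by rewrite /D/= in_itv/= => /andP[+ _]; apply: lt_le_trans; rewrite invr_gt0.
have cpow b x : 0 < x -> {for x, continuous (fun y => y `^ b)}.
  move=> x0; apply: differentiable_continuous; apply/derivable1_diffP.
  by apply: derivable_powR; rewrite in_itv/= x0.
have mf : measurable_fun setT f.
  apply: measurable_funM; first by apply: measurable_funM => //;
    exact: measurable_powR.
  under eq_fun do rewrite -powR_invn ?ltW//.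
  apply: (measurableT_comp (measurable_powR _)).
  by apply: measurable_funD => //; exact: measurable_powR.
apply: (@le_trans _ _ (\int[mu]_(x in D n) (C * f x)%:E)%E).
  apply: ge0_le_integral => //.
  - exact: measurable_itv.
  - by move=> x _; rewrite lee_fin.
  - exact/measurable_EFinP/measurable_funTS.
  - by apply/measurable_EFinP/measurable_funTS/measurable_funM.
  - by move=> x Dx; rewrite lee_fin; apply: gf; exact: Dpos.
under eq_integral do rewrite EFinM.
rewrite ge0_integralZl//; last 3 first.
  - exact: measurable_itv.
  - exact/measurable_EFinP/measurable_funTS.
  - by move=> x _; rewrite lee_fin.
rewrite -[leRHS]mule1 lee_wpmul2l//.
have dF x : 0 < x -> is_derive x 1 F (f x).
  move=> x0; rewrite /F /f.
  have dp := is_derive1_powR a x0.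
  have dg : is_derive x 1 (fun y => 1 + y `^ a) (a * x `^ (a - 1)).
    by have := is_deriveD (is_derive_cst (1 : R) x 1) dp; rewrite add0r.
  split.
    by apply/derivableN/derivableV; rewrite ?gt_eqF.
  rewrite deriveN; last by apply: derivableV; rewrite ?gt_eqF.
  rewrite deriveV ?gt_eqF// derive_val.
  by rewrite scaleNr opprK [LHS]mulrC.
have cF x : 0 < x -> {for x, continuous F}.
  move=> /dF dFx; apply: differentiable_continuous; apply/derivable1_diffP.
  by apply: ex_derive.
have cf x : 0 < x -> {for x, continuous f}.
  move=> x0; rewrite /f; apply: cvgM.
    by apply: cvgM; [exact: cvg_cst|exact: cpow].
  apply: cvgV; first by rewrite expf_neq0// gt_eqF.
  apply: (@continuous_comp _ _ _ (fun y => 1 + y `^ a) (fun y => y ^+ 2)).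
    by apply: (@continuousD _ R^o _ (cst 1));
      [exact: cst_continuous|exact: cpow].
  exact: exprn_continuous.
(* [D 0] is the single point 1, while the fundamental theorem of calculus is applied on a
   nondegenerate interval. *)
have [n0|n0] := eqVneq n 0%N.
  rewrite n0 /D invr1 set_itv1 integral_set1 ?lebesgue_measure_set1 ?mule0//.
rewrite (@continuous_FTC2 _ f F).
- rewrite -EFinB lee_fin /F opprK addrC lerBlDr.
  rewrite (@le_trans _ _ 1)//; last by rewrite lerDl invr_ge0 ltW.
  by rewrite invf_le1// lerDl powR_ge0.
- rewrite (@lt_trans _ _ 1)// ?invf_lt1 ?ltr1n ?ltnS ?lt0n//.
- by apply: continuous_in_subspaceT => x /set_mem /Dpos; exact: cf.
- have nV : 0 < n.+1%:R^-1 :> R by rewrite invr_gt0.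
  split.
  + move=> x; rewrite in_itv/= => /andP[/(lt_trans nV) x0 _].
    exact/ex_derive/dF.
  + by apply: cvg_at_right_filter; exact: cF.
  + by apply: cvg_at_left_filter; exact: cF.
- move=> x; rewrite in_itv/= => /andP[+ _].
  have nV : 0 < n.+1%:R^-1 :> R by rewrite invr_gt0.
  by move=> /(lt_trans nV)/dF dFx; rewrite derive1E derive_val.
Qed.

Lemma Gamma_fun_fin a : 0 < a ->
  (\int[mu]_(x in `]0%R, +oo[) (x `^ (a - 1) * expR (- x))%:E =
   (Gamma_fun a)%:E)%E.
Proof.
move=> a0; rewrite /Gamma_fun /Rintegral fineK// ge0_fin_numE; last first.
  by apply: integral_ge0 => x _; rewrite lee_fin mulr_ge0 ?powR_ge0 ?expR_ge0.
exact: gamma_integral_finite.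
Qed.

Lemma Gamma_fun_gt0 a : 0 < a -> 0 < Gamma_fun a.
Proof.
move=> a0; rewrite -lte_fin -Gamma_fun_fin//.
(* A lower bound of the integrand on [1, 2]: there ln x lies between 0 and ln 2, and the absolute
   value treats both signs of [a - 1] at once. *)
pose c := expR (- `|a - 1| * ln 2) * expR (- 2) : R.
have c0 : 0 < c by rewrite mulr_gt0// expR_gt0.
have mg := measurable_gam a.
apply: (@lt_le_trans _ _ (\int[mu]_(x in `[1%R, 2%R]) c%:E)%E).
  rewrite integral_cst//.
  rewrite /= lebesgue_measure_itv/= lte_fin ltr1n/=.
  by rewrite -EFinB -EFinM lte_fin mulr_gt0// subr_gt0 ltr1n.
apply: (@le_trans _ _ (\int[mu]_(x in `[1%R,
  2%R]) (x `^ (a - 1) * expR (- x))%:E)%E).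
  apply: ge0_le_integral => //.
  - by move=> x _; rewrite lee_fin ltW.
  - apply/measurable_EFinP; apply: measurable_funTS; exact: mg.
  - move=> x /=; rewrite in_itv/= => /andP[x1 x2]; rewrite lee_fin.
    have x0 : 0 < x by exact: lt_le_trans x1.
    apply: ler_pM; rewrite ?expR_ge0 ?ler_expR ?lerN2//.
    rewrite /powR gt_eqF// ler_expR mulNr lerNl -mulNr.
    have lx0 : 0 <= ln x by exact: ln_ge0.
    have lx2 : ln x <= ln 2 by rewrite ler_ln ?posrE.
    rewrite (@le_trans _ _ (`|a - 1| * ln x))//; last by rewrite ler_wpM2l.
    by rewrite ler_wpM2r// -normrN ler_norm.
apply: ge0_subset_integral => //=.
- apply/measurable_EFinP; apply: measurable_funTS; exact: mg.
- by move=> x _; rewrite lee_fin mulr_ge0 ?powR_ge0 ?expR_ge0.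
- move=> x /=; rewrite !in_itv/= andbT => /andP[x1 _].
  exact: lt_le_trans x1.
Qed.

Lemma gamma_integralE a s : 0 < a -> 0 < s ->
  (\int[mu]_(x in `]0%R, +oo[) (x `^ (a - 1) * expR (- (s * x)))%:E =
   (Gamma_fun a)%:E * (s `^ (- a))%:E)%E.
Proof.
move=> a0 s0.
rewrite -Gamma_fun_fin// muleC (@ge0_integral_scale R s (EFin \o gam a))//;
  last 2 first.
- by apply/measurable_EFinP; exact: measurable_gam.
- by move=> x; rewrite lee_fin.
have -> : (\int[mu]_(x in `]0%R, +oo[) (EFin \o gam a) (s * x)%R =
    (s `^ (a - 1))%:E *
    \int[mu]_(x in `]0%R, +oo[) (x `^ (a - 1) * expR (- (s * x)))%:E)%E.
  rewrite -ge0_integralZl//; last 3 first.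
  - apply/measurable_EFinP; apply: measurable_funTS;
    exact: measurable_gamma_integrand.
  - by move=> x _; rewrite lee_fin mulr_ge0 ?powR_ge0 ?expR_ge0.
  - by rewrite lee_fin powR_ge0.
  apply: eq_integral => x; rewrite inE/= in_itv/= andbT => x0.
  by rewrite -EFinM /gam powRM ?mulrA// ltW.
rewrite !muleA -!EFinM -[LHS]mul1e; congr (_%:E * _)%E.
by rewrite -mulrA mulr_powRB1 ?(ltW s0)// powRN mulVf// gt_eqF// powR_gt0.
Qed.

End gamma_integral.

(** * Moments of an exponentially tilted measure *)

Lemma exprn_le_expR (R : realType) (n : nat) (y : R) : 0 <= y ->
  y ^+ n <= n`!%:R * expR y.
Proof.
move=> y0; case: n => [|n].
  by rewrite expr0 fact0 mul1r -expR0 ler_expR.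
rewrite mulrC -ler_pdivrMr ?ltr0n ?fact_gt0//.
by apply: le_trans (expR_ge1Dxn n y0); rewrite lerDr.
Qed.

Section weighted_laplace.
Context d (T : measurableType d) (R : realType) (m : {measure set T -> \bar R}).
Variables (X w : T -> R).
Hypotheses (mX : measurable_fun setT X) (mw : measurable_fun setT w).
Hypothesis w0 : forall t, 0 <= w t.

Let L (th : R) : \bar R := (\int[m]_t (w t * expR (- (th * X t)))%:E)%E.
Let f (n : nat) (th : R) (t : T) :
  R := (- X t) ^+ n * (w t * expR (- (th * X t))).
Let F (n : nat) (th : R) : R := (\int[m]_t f n th t)%R.

Lemma measurable_weighted_exp th :
  measurable_fun setT (fun t => w t * expR (- (th * X t))).
Proof.
apply: measurable_funM => //; apply: measurableT_comp => //.
by apply: measurable_funN; exact: measurable_funM.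
Qed.

Let mf n th : measurable_fun setT (f n th).
Proof.
apply: measurable_funM; last exact: measurable_weighted_exp.
by apply: measurable_funX; exact: measurable_funN.
Qed.

Lemma weighted_exp_ge0 th t : 0 <= w t * expR (- (th * X t)).
Proof. by rewrite mulr_ge0// expR_ge0. Qed.

Lemma weighted_exp_integrable th : (L th < +oo)%E ->
  m.-integrable setT (fun t => (w t * expR (- (th * X t)))%:E).
Proof.
move=> Lth; apply/integrableP; split.
  by apply/measurable_EFinP; exact: measurable_weighted_exp.
rewrite (eq_integral (fun t => (w t * expR (- (th * X t)))%:E))//.
by move=> t _; rewrite gee0_abs// lee_fin weighted_exp_ge0.
Qed.

(** A majorant of [f n th] uniform in [th] within [de] of [th0]. One factor exp (de |X|) absorbs the
    power of [X], another the shift of [th], and exp (2 de |X|) is at most the sum of the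
    exponentials of 2 de X and - 2 de X; hence the two transforms at [th0 - 2 * de] and
    [th0 + 2 * de]. *)
Let G (n : nat) (de th0 : R) (t : T) : R := n`!%:R / de ^+ n *
  (w t * expR (- ((th0 - 2 * de) * X t)) + w t * expR (- ((th0 +
    2 * de) * X t))).

Let G_ge0 n (de th0 : R) t : 0 < de -> 0 <= G n de th0 t.
Proof.
move=> de0; apply: mulr_ge0; first by rewrite divr_ge0// exprn_ge0// ltW.
by rewrite addr_ge0// weighted_exp_ge0.
Qed.

Let f_le_G n (de th0 th : R) t : 0 < de -> `|th - th0| < de ->
  `|f n th t| <= G n de th0 t.
Proof.
move=> de0 hth; rewrite /f /G normrM (ger0_norm (weighted_exp_ge0 _ _)).
rewrite normrX normrN.
have h1 : `|X t| ^+ n <= n`!%:R / de ^+ n * expR (de * `|X t|).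
  rewrite mulrAC ler_pdivlMr ?exprn_gt0// -exprMn mulrC.
  by apply: exprn_le_expR; rewrite mulr_ge0// ltW.
have h2 : expR (- (th * X t)) <= expR (- (th0 * X t) + de * `|X t|).
  have : (th0 - th) * X t <= de * `|X t|.
    by rewrite (le_trans (ler_norm _))// normrM ler_wpM2r// distrC ltW.
  by rewrite ler_expR mulrBl => ?; lra.
have h3 : expR (de * `|X t|) * expR (- (th0 * X t) + de * `|X t|) <=
    expR (- ((th0 - 2 * de) * X t)) + expR (- ((th0 + 2 * de) * X t)).
  rewrite -expRD; case: (ger0P (X t)) => Xt.
    apply: (@le_trans _ _ (expR (- ((th0 - 2 * de) * X t)))).
      by rewrite ler_expR; lra.
    by rewrite lerDl expR_ge0.
  apply: (@le_trans _ _ (expR (- ((th0 + 2 * de) * X t)))).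
    by rewrite ler_expR; lra.
  by rewrite lerDr expR_ge0.
rewrite -mulrDr mulrCA [leRHS]mulrCA ler_wpM2l//.
apply: (@le_trans _ _ (n`!%:R / de ^+ n * expR (de * `|X t|) *
   expR (- (th0 * X t) + de * `|X t|))).
  by apply: ler_pM; rewrite ?exprn_ge0 ?expR_ge0.
rewrite -mulrA ler_wpM2l//; apply: divr_ge0 => //.
by apply: exprn_ge0; exact: ltW.
Qed.

Let G_integrable n (de th0 : R) : (L (th0 - 2 * de) < +oo)%E ->
  (L (th0 + 2 * de) < +oo)%E -> m.-integrable setT (EFin \o G n de th0).
Proof.
move=> h1 h2; rewrite /comp /G.
under eq_fun do rewrite EFinM EFinD.
by apply: integrableZl => //; apply: integrableD => //;
  exact: weighted_exp_integrable.
Qed.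

Let f_integrable n (de th0 th : R) : 0 < de -> `|th - th0| < de ->
  (L (th0 - 2 * de) < +oo)%E -> (L (th0 + 2 * de) < +oo)%E ->
  m.-integrable setT (EFin \o f n th).
Proof.
move=> de0 hth h1 h2; apply: (le_integrable measurableT _ _ (G_integrable n h1
  h2)).
  by apply/measurable_EFinP; exact: mf.
move=> t _ /=; rewrite lee_fin [leRHS]ger0_norm ?G_ge0//.
exact: f_le_G.
Qed.

Variables (u v : R).
Hypothesis Lfin : forall th, u < th < v -> (L th < +oo)%E.

Let radius th : u < th < v -> exists2 de : R, 0 < de &
  [/\ u < th - 2 * de < v & u < th + 2 * de < v].
Proof.
move=> /andP[uth thv]; exists (Num.min (th - u) (v - th) / 4).
  by rewrite divr_gt0// lt_min !subr_gt0 uth thv.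
set d0 := Num.min _ _.
have : d0 <= th - u by rewrite ge_min lexx.
have : d0 <= v - th by rewrite ge_min lexx orbT.
have : 0 < d0 by rewrite lt_min !subr_gt0 uth thv.
by move=> ? ? ?; split; apply/andP; split; lra.
Qed.

Lemma moment_integrable n th : u < th < v ->
  m.-integrable setT
    (fun t => ((- X t) ^+ n * (w t * expR (- (th * X t))))%:E).
Proof.
move=> hth; have [de de0 [h1 h2]] := radius hth.
by apply: (f_integrable _ de0 (th0 := th));
  [rewrite subrr normr0|exact: Lfin|exact: Lfin].
Qed.

(** Differentiating the exponential in [th] brings down [- X t], which turns [f n] into [f n.+1];
    the majorant [G n.+1] permits differentiation under the integral. *)
Lemma moment_is_derive n th : u < th < v -> is_derive th 1 (F n) (F n.+1 th).
Proof.
move=> hth; have [de de0 [h1 h2]] := radius hth.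
have [l1 l2] := (Lfin h1, Lfin h2).
have Ith : `](th - de), (th + de)[%classic th.
  by rewrite /= in_itv/= ltrBlDr !ltrDl de0.
have inI (x : R) : `](th - de), (th + de)[%classic x -> `|x - th| < de.
  by rewrite /= in_itv/= -ltr_distl.
have dfx (x : R) (t : T) : is_derive x 1 (fun y => f n y t) (f n.+1 x t).
  have dl : is_derive x 1 (fun y : R => - (y * X t)) (- X t).
    have -> : (fun y : R => - (y * X t)) = (fun y => - X t *: y).
      by apply/funext => y; rewrite scaleNr /GRing.scale/= mulrC.
    by apply: is_derive_eq; rewrite /GRing.scale/= mulr1.
  have de1 := @is_derive1_comp _ expR (fun y =>
    - (y * X t)) x _ _ (is_derive_expR _) dl.
  have -> : (fun y => f n y t) =
      ((- X t) ^+ n * w t) *: (expR \o (fun y => - (y * X t))).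
    by apply/funext => y; rewrite /f mulrA.
  by apply: is_derive_eq; rewrite /f /GRing.scale/= exprS; ring.
have d1 (x : R) t : partial1of2 (f n) x t = f n.+1 x t.
  by rewrite partial1of2E derive_val.
have H1 (x : R) : `](th - de),
  (th + de)[%classic x -> m.-integrable setT (EFin \o f n x).
  by move=> /inI xde; exact: (f_integrable _ de0 xde).
have H2 (x : R) y : `](th - de),
  (th + de)[%classic x -> setT y -> derivable (f n ^~ y) x 1.
  by move=> _ _; exact: ex_derive.
have H3 (x : R) y : `](th - de), (th + de)[%classic x -> setT y ->
    `|partial1of2 (f n) x y| <= G n.+1 de th y.
  by move=> /inI xde _; rewrite d1; exact: f_le_G.
have G0 y : 0 <= G n.+1 de th y by exact: G_ge0.
split.
  exact: (derivable_under_integral measurableT Ith H1 H2 G0 (G_integrable _ l1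
    l2) H3).
rewrite -derive1E.
rewrite (differentiation_under_integral measurableT Ith H1 H2 G0 (G_integrable
  _ l1 l2) H3).
by apply: eq_Rintegral => t _; rewrite d1.
Qed.

Variables (K A B lam : R).
Hypothesis AB0 : forall th, u < th < v -> 0 < A + B * th.
Hypothesis LE : forall th, u < th < v ->
  L th = (K * (A + B * th) `^ (- lam))%:E.

(** Induction by differentiating the formula for the previous moment: each derivative contributes
    [- B] and the next factor [lam + n] of the Pochhammer symbol. *)
Lemma momentE n th : u < th < v ->
  (\int[m]_t ((- X t) ^+ n * (w t * expR (- (th * X t)))) =
   K * (- B) ^+ n * pochhammer lam n * (A + B * th) `^ (- lam - n%:R))%R.
Proof.
rewrite -/(F n th).
elim: n th => [th hth|n IH th hth].
  rewrite expr0 mulr1 subr0 mulr1 /F /Rintegral /f.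
  under eq_integral do rewrite expr0 mul1r.
  by rewrite -/(L th) LE.
have p0 := AB0 hth.
have dg : is_derive th 1 (fun y : R => A + B * y) B.
  have := is_deriveD (is_derive_cst A th 1) (is_deriveZ B (is_derive_id th 1)).
  by rewrite add0r /GRing.scale/= mulr1.
have dc := @is_derive1_comp _ (fun y : R => y `^ (- lam - n%:R)) (fun y =>
  A + B * y) th _ _
  (is_derive1_powR _ p0) dg.
have dZ := is_deriveZ (K * (- B) ^+ n * pochhammer lam n) dc.
have dF : is_derive th 1 (F n) ((K * (- B) ^+ n * pochhammer lam n) *:
    ((- lam - n%:R) * (A + B * th) `^ (- lam - n%:R - 1) * B)).
  apply: near_eq_is_derive dZ.
  have : \forall y \near th, y \in `]u, v[ by apply: near_in_itvoo;
    rewrite in_itv.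
  by apply: filterS => y; rewrite in_itv/= => hy; rewrite IH.
rewrite -(@derive_val _ _ _ _ _ _ _ (moment_is_derive n hth)) derive_val.
rewrite /GRing.scale/= -[n.+1%:R]natr1 opprD addrA exprS; ring.
Qed.

End weighted_laplace.

(** * Exponential integrals determined by moments *)

Section exponential_series.
Context {R : realType}.
Implicit Types y : R.

Lemma cvg_series_expR y : series (fun n => y ^+ n / n`!%:R) @ \oo --> expR y.
Proof. exact: is_cvg_series_exp_coeff. Qed.

Lemma exprDN_ge0 y n : 0 <= y ^+ n + (- y) ^+ n.
Proof.
rewrite exprNn -signr_odd; case: (boolP (odd n)) => on.
  by rewrite expr1 mulN1r subrr.
by rewrite expr0 mul1r addr_ge0// real_exprn_even_ge0// ?num_real.
Qed.

Lemma expRDN_nneseries y :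
  (\sum_(n <oo) ((y ^+ n + (- y) ^+ n) / n`!%:R)%:E =
   (expR y + expR (- y))%:E)%E.
Proof.
apply/cvg_lim => //.
have -> : (fun n => \sum_(0 <= k < n) ((y ^+ k + (- y) ^+ k) / k`!%:R)%:E)%E =
   EFin \o (series (fun n => y ^+ n / n`!%:R) \+
            series (fun n => (- y) ^+ n / n`!%:R)).
  apply/funext => n; rewrite /= sumEFin; congr (_%:E).
  by rewrite /series /= -big_split/=; apply: eq_bigr => i _; rewrite mulrDl.
apply: cvg_EFin; first exact: nearW.
by apply: cvgD; exact: cvg_series_expR.
Qed.

End exponential_series.

Section moments_determine.
Context d (T : measurableType d) (R : realType) (m : {measure set T -> \bar R}).
Variables (X w : T -> R).
Hypotheses (mX : measurable_fun setT X) (mw : measurable_fun setT w).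
Hypothesis w0 : forall t, 0 <= w t.
Hypothesis iX : forall n, m.-integrable setT (fun t => (X t ^+ n * w t)%:E).

Let M n : R := (\int[m]_t (X t ^+ n * w t))%R.

(* All terms are nonnegative (the odd ones vanish), so no integrability of
   the exponentials is required: this is how finiteness propagates. *)
Lemma integral_cosh_moments (h : R) :
  (\int[m]_t (w t * (expR (h * X t) + expR (- (h * X t))))%:E =
   \sum_(n <oo) ((h ^+ n + (- h) ^+ n) / n`!%:R * M n)%:E)%E.
Proof.
have E n t : (w t * (((h * X t) ^+ n + (- (h * X t)) ^+ n) / n`!%:R))%:E =
    (((h ^+ n + (- h) ^+ n) / n`!%:R)%:E * (X t ^+ n * w t)%:E)%E.
  by rewrite -EFinM; congr (_%:E); rewrite -mulNr !exprMn; ring.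
transitivity (\int[m]_t \sum_(n <oo)
    ((w t * (((h * X t) ^+ n + (- (h * X t)) ^+ n) / n`!%:R))%:E))%E.
  apply: eq_integral => t _.
  rewrite EFinM -expRDN_nneseries -nneseriesZl// => n _.
  by rewrite lee_fin mulr_ge0 ?invr_ge0// exprDN_ge0.
rewrite integral_nneseries//; last 2 first.
- move=> n; under eq_fun do rewrite E -EFinM.
  apply/measurable_EFinP; do 2 apply: measurable_funM => //.
  exact: measurable_funX.
- by move=> n t _; rewrite lee_fin mulr_ge0// mulr_ge0 ?invr_ge0// exprDN_ge0.
apply: eq_eseriesr => n _.
under eq_integral do rewrite E.
rewrite integralZl// [RHS]EFinM; congr (_ * _)%E.
by rewrite /M /Rintegral fineK//; exact: integrable_fin_num.
Qed.

(** Dominated convergence: every partial sum of the exponential series is at most exp |h X|, hence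
    at most the integrand assumed to be integrable. *)
Lemma integral_expR_moments (h : R) :
  (\int[m]_t (w t * (expR (h * X t) + expR (- (h * X t))))%:E < +oo)%E ->
  (fun N => \sum_(0 <= n < N) h ^+ n / n`!%:R * M n) @ \oo -->
    fine (\int[m]_t (w t * expR (h * X t))%:E)%E /\
  (\int[m]_t (w t * expR (h * X t))%:E < +oo)%E.
Proof.
move=> fin.
pose g t := w t * (expR (h * X t) + expR (- (h * X t))).
have g0 t : 0 <= g t by rewrite mulr_ge0// addr_ge0// expR_ge0.
have mhX : measurable_fun setT (fun t => h * X t) by exact: measurable_funM.
have mexp : measurable_fun setT (fun t => expR (h * X t)).
  exact: measurableT_comp.
have mg : measurable_fun setT g.
  apply: measurable_funM => //; apply: measurable_funD => //.
  by apply: measurableT_comp => //; exact: measurable_funN.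
have ig : m.-integrable setT (EFin \o g).
  apply/integrableP; split; first exact/measurable_EFinP.
  by under eq_integral do rewrite /= ger0_norm//.
split; last first.
  apply: le_lt_trans fin; apply: ge0_le_integral => //.
  - by move=> t _; rewrite lee_fin mulr_ge0// expR_ge0.
  - by apply/measurable_EFinP/measurable_funM.
  - exact/measurable_EFinP.
  - by move=> t _; rewrite lee_fin ler_wpM2l// lerDl expR_ge0.
pose s N t := \sum_(0 <= n < N) (h * X t) ^+ n / n`!%:R.
have sE N t : w t * s N t = \sum_(0 <= n < N) h ^+ n / n`!%:R * (X t ^+ n *
  w t).
  by rewrite mulr_sumr; apply: eq_bigr => n _; rewrite exprMn; ring.
have intE N : (\int[m]_t (w t *
  s N t)%:E = (\sum_(0 <= n < N) h ^+ n / n`!%:R * M n)%:E)%E.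
  under eq_integral do rewrite sE -sumEFin.
  rewrite integral_sum//; last first.
    move=> n; under eq_fun do rewrite EFinM.
    by apply: integrableZl.
  rewrite -sumEFin; apply: eq_bigr => n _.
  under eq_integral do rewrite EFinM.
  rewrite integralZl// [RHS]EFinM; congr (_ * _)%E.
  by rewrite /M /Rintegral fineK//; exact: integrable_fin_num.
have := @dominated_cvg _ _ _ m setT measurableT (fun N t => (w t * s N t)%:E)
  (fun t => (w t * expR (h * X t))%:E) (EFin \o g).
under eq_fun do rewrite intE.
move=> dc.
suff : (fun N => (\sum_(0 <= n < N) h ^+ n / n`!%:R * M n)%:E) @ \oo -->
    (fine (\int[m]_t (w t * expR (h * X t))%:E))%:E by move/fine_cvg.
rewrite fineK; last first.
  apply: integrable_fin_num => //; apply: le_integrable ig => //.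
    by apply/measurable_EFinP/measurable_funM.
  move=> t _ /=; rewrite lee_fin !ger0_norm//;
    last by rewrite mulr_ge0// expR_ge0.
  by rewrite ler_wpM2l// lerDl expR_ge0.
apply: dc => //.
- move=> N; under eq_fun do rewrite sE -sumEFin.
  apply: emeasurable_sum => n; apply/measurable_EFinP;
    apply: measurable_funM => //.
  by apply: measurable_funM => //; exact: measurable_funX.
- move=> t _; apply: cvg_EFin; first exact: nearW.
  by apply: cvgMr; exact: cvg_series_expR.
- move=> N t _ /=; rewrite lee_fin normrM (ger0_norm (w0 t)) ler_wpM2l//.
  apply: le_trans (ler_norm_sum _ _ _) _.
  apply: (@le_trans _ _ (expR `|h * X t|)).
    rewrite (eq_bigr (fun n => `|h * X t| ^+ n / n`!%:R)); last first.
      by move=> n _; rewrite normrM normrX normfV (ger0_norm (ler0n _ _)).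
    have cs := @cvg_series_expR R `|h * X t|.
    rewrite -(cvg_lim _ cs)//; apply: nondecreasing_cvgn_le;
      last by apply/cvg_ex; eexists; exact: cs.
    by apply: nondecreasing_series => n _ _; rewrite divr_ge0// exprn_ge0.
  by case: (ger0P (h * X t)) => _; rewrite ?lerDl ?lerDr expR_ge0.
Qed.

End moments_determine.

(** By [integral_cosh_moments] equal moments force equal hyperbolic cosine integrals, so finiteness
    passes from [m'] to [m]; both exponential integrals are then limits of the same partial sums. *)
Lemma laplace_same_moments d (T : measurableType d) d' (T' : measurableType d')
    (R : realType) (m : {measure set T -> \bar R})
    (m' : {measure set T' -> \bar R}) (X w : T -> R) (X' w' : T' -> R) (h : R) :
  measurable_fun setT X -> measurable_fun setT w -> (forall t, 0 <= w t) ->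
  measurable_fun setT X' -> measurable_fun setT w' -> (forall t, 0 <= w' t) ->
  (forall n, m.-integrable setT (fun t => (X t ^+ n * w t)%:E)) ->
  (forall n, m'.-integrable setT (fun t => (X' t ^+ n * w' t)%:E)) ->
  (forall n, \int[m]_t (X t ^+ n * w t) = \int[m']_t (X' t ^+ n * w' t))%R ->
  (\int[m']_t (w' t * (expR (h * X' t) + expR (- (h * X' t))))%:E < +oo)%E ->
  (\int[m]_t (w t * expR (h * X t))%:E =
   \int[m']_t (w' t * expR (h * X' t))%:E)%E.
Proof.
move=> mX mw w0 mX' mw' w0' iX iX' MM' fin'.
have fin : (\int[m]_t (w t * (expR (h * X t) + expR (- (h * X t))))%:E < +oo)%E.
  rewrite integral_cosh_moments//.
  under eq_eseriesr do rewrite MM'.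
  by rewrite -integral_cosh_moments.
have [c l] := integral_expR_moments mX mw w0 iX fin.
have [c' l'] := integral_expR_moments mX' mw' w0' iX' fin'.
rewrite -[LHS]fineK; last first.
  by rewrite ge0_fin_numE// integral_ge0// => t _;
    rewrite lee_fin mulr_ge0 ?expR_ge0.
rewrite -[RHS]fineK; last first.
  by rewrite ge0_fin_numE// integral_ge0// => t _;
    rewrite lee_fin mulr_ge0 ?expR_ge0.
congr (_%:E); rewrite -(cvg_lim _ c)// -(cvg_lim _ c')//.
by congr (limn _); apply/funext => N; apply: eq_bigr => n _; rewrite MM'.
Qed.

(** * The gamma kernel on the whole line *)

Section gamma_weight.
Context {R : realType}.
Notation mu := (@lebesgue_measure R).

(** The indicator turns integrals over the half-line into integrals over [R] and discards the values
    of [powR] at nonpositive bases. *)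
Definition gamma_weight (b x : R) : R := x `^ (b - 1) * \1_(`]0, +oo[) x.

Lemma measurable_gamma_weight b : measurable_fun setT (gamma_weight b).
Proof.
by apply: measurable_funM => //; exact: measurable_powR.
Qed.

Lemma gamma_weight_ge0 b x : 0 <= gamma_weight b x.
Proof. by rewrite mulr_ge0// powR_ge0. Qed.

Lemma gamma_weightX b x n :
  x ^+ n * gamma_weight b x = gamma_weight (b + n%:R) x.
Proof.
rewrite /gamma_weight indicE; case: (boolP (x \in _)) => [|_];
  last by rewrite !mulr0.
rewrite inE/= in_itv/= andbT => x0; rewrite !mulr1 -(powR_mulrn n (ltW x0)).
rewrite -powRD; last by rewrite (gt_eqF x0) implybT.
by congr (_ `^ _); ring.
Qed.

Lemma gamma_weight_integral (b s : R) : 0 < b -> 0 < s ->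
  (\int[mu]_x (gamma_weight b x * expR (- (s * x)))%:E =
   (Gamma_fun b * s `^ (- b))%:E)%E.
Proof.
move=> b0 s0; rewrite [RHS]EFinM -gamma_integralE// [RHS]integral_mkcond.
apply: eq_integral => x _; rewrite epatch_indic/= -EFinM /gamma_weight.
by congr (_%:E); ring.
Qed.

Lemma gamma_weight_integrable (b s : R) : 0 < b -> 0 < s ->
  mu.-integrable setT (fun x => (gamma_weight b x * expR (- (s * x)))%:E).
Proof.
move=> b0 s0.
apply: (@weighted_exp_integrable _ (measurableTypeR R) R mu (fun x => x)
  (gamma_weight b) (@measurable_id _ _ _) (measurable_gamma_weight b)
  (gamma_weight_ge0 b)).
by rewrite gamma_weight_integral ?ltry.
Qed.

(** The transform of the gamma kernel is [Gamma_fun b] times a power of [th], so [momentE] with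
    [A = 0], [B = 1] at [th = 1] gives its moments, without integration by parts. *)
Lemma Gamma_funD (b : R) n : 0 < b ->
  Gamma_fun (b + n%:R) = pochhammer b n * Gamma_fun b.
Proof.
move=> b0.
have LE (th : R) : 0 < th < 2 -> (\int[mu]_x (gamma_weight b x * expR (- (th *
  x)))%:E =
    (Gamma_fun b * (0 + 1 * th) `^ (- b))%:E)%E.
  by move=> /andP[th0 _]; rewrite add0r mul1r gamma_weight_integral.
have bn0 : 0 < b + n%:R by rewrite ltr_wpDr.
have Lfin (th : R) : 0 < th < 2 ->
    (\int[mu]_x (gamma_weight b x * expR (- (th * x)))%:E < +oo)%E.
  by move=> hth; rewrite LE// ltry.
have AB0 (th : R) : 0 < th < 2 -> 0 < 0 + 1 * th.
  by move=> /andP[th0 _]; rewrite add0r mul1r.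
have := @momentE _ (measurableTypeR R) R mu (fun x => x) (gamma_weight b)
  (@measurable_id _ _ _) (measurable_gamma_weight b) (gamma_weight_ge0 b) 0 2
    Lfin
  (Gamma_fun b) 0 1 b AB0 LE n 1.
rewrite add0r mul1r powR1 mulr1 ltr01 ltr1n => /(_ erefl) h.
have E : (\int[mu]_t ((- t) ^+ n * (gamma_weight b t * expR (- (1 * t)))) =
    (-1) ^+ n * Gamma_fun (b + n%:R))%R.
  have <- : (\int[mu]_t (gamma_weight (b + n%:R) t * expR (- (1 * t))) =
      Gamma_fun (b + n%:R))%R.
    by rewrite /Rintegral gamma_weight_integral//= powR1 mulr1.
  rewrite -[RHS]RintegralZl//; last exact: gamma_weight_integrable.
  apply: eq_Rintegral => t _.
  by rewrite -gamma_weightX [in LHS](exprNn t) !mulrA.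
apply: (@mulfI _ ((-1) ^+ n)); first by rewrite signr_eq0.
by rewrite -E h; ring.
Qed.

End gamma_weight.

(** * Transforms of gamma type along a line *)

Section gamma_line.
Context d (T : measurableType d) (R : realType) (m : {measure set T -> \bar R}).
Variables (X w : T -> R).
Hypotheses (mX : measurable_fun setT X) (mw : measurable_fun setT w).
Hypothesis w0 : forall t, 0 <= w t.
Variables (K A B lam : R).
Hypotheses (K0 : 0 <= K) (lam0 : 0 < lam).
Notation mu := (@lebesgue_measure R).

Let L (th : R) : \bar R := (\int[m]_t (w t * expR (- (th * X t)))%:E)%E.

(** The moments at [a] are those of a rescaled gamma variable, so the exponential integral at
    [a + h] is computed on the gamma side. The hyperbolic cosine integral there is finite because
    [1 + h * (B / W)] and [1 - h * (B / W)] are both positive, which is the condition on [B * h]. *)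
Lemma gamma_line_step u v a h :
  (forall th, u < th < v -> 0 < A + B * th) ->
  (forall th, u < th < v -> L th = (K * (A + B * th) `^ (- lam))%:E) ->
  u < a < v -> `|B * h| < A + B * a ->
  L (a + h) = (K * (A + B * (a + h)) `^ (- lam))%:E.
Proof.
move=> AB0 LE hua hW; set W := A + B * a in hW.
have W0 : 0 < W by exact: AB0.
have G0 := Gamma_fun_gt0 lam0.
pose c := K * W `^ (- lam) / Gamma_fun lam.
have c0 : 0 <= c by rewrite divr_ge0 ?(ltW G0)// mulr_ge0// powR_ge0.
(* Tilted at a, - X has the moments of - (B / W) times a gamma variable. *)
pose X' (x : R) : R := - (B / W) * x.
pose w' (x : R) : R := c * (gamma_weight lam x * expR (- (1 * x))).
have mw' : measurable_fun setT w'.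
  apply: measurable_funM => //; apply: measurable_weighted_exp => //.
  exact: measurable_gamma_weight.
have w'0 t : 0 <= w' t.
  by rewrite mulr_ge0// mulr_ge0 ?expR_ge0// gamma_weight_ge0.
have Lfin th : u < th < v -> (L th < +oo)%E by move=> hth; rewrite LE// ltry.
have X'n n x : X' x ^+ n * w' x = c * (- (B / W)) ^+ n *
    (gamma_weight (lam + n%:R) x * expR (- (1 * x))).
  by rewrite /X' /w' exprMn -gamma_weightX; ring.
have iw' n : mu.-integrable setT
    (fun x => (gamma_weight (lam + n%:R) x * expR (- (1 * x)))%:E).
  by apply: gamma_weight_integrable => //; rewrite ltr_wpDr.
have hw1 : 0 < 1 + h * (B / W).
  rewrite -(pmulr_rgt0 _ W0) mulrDr mulr1.
  have -> : W * (h * (B / W)) = B * h by field; rewrite gt_eqF.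
  by move: hW; rewrite ltr_norml => /andP[+ _]; lra.
have hw2 : 0 < 1 - h * (B / W).
  rewrite -(pmulr_rgt0 _ W0) mulrDr mulr1.
  have -> : W * (- (h * (B / W))) = - (B * h) by field; rewrite gt_eqF.
  by move: hW; rewrite ltr_norml => /andP[_]; lra.
have Ew' (s : R) : 0 < s -> (\int[mu]_x (c * (gamma_weight lam x *
  expR (- (s * x))))%:E =
    (K * W `^ (- lam) * s `^ (- lam))%:E)%E.
  move=> s0; under eq_integral do rewrite EFinM.
  rewrite ge0_integralZl//; last 2 first.
  - by apply/measurable_EFinP; apply: measurable_weighted_exp => //;
    exact: measurable_gamma_weight.
  - by move=> x _; rewrite lee_fin mulr_ge0 ?expR_ge0// gamma_weight_ge0.
  rewrite gamma_weight_integral// -EFinM /c; congr (_%:E).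
  by field; rewrite gt_eqF.
have e1 x : w' x * expR (h * X' x) =
    c * (gamma_weight lam x * expR (- ((1 + h * (B / W)) * x))).
  rewrite /w' -[LHS]mulrA -[X in c * X]mulrA -expRD; congr (_ * (_ * expR _)).
  by rewrite /X'; ring.
have e2 x : w' x * expR (- (h * X' x)) =
    c * (gamma_weight lam x * expR (- ((1 - h * (B / W)) * x))).
  rewrite /w' -[LHS]mulrA -[X in c * X]mulrA -expRD; congr (_ * (_ * expR _)).
  by rewrite /X'; ring.
have main := @laplace_same_moments _ T _ (measurableTypeR R) R m mu
  (fun t => - X t) (fun t => w t * expR (- (a * X t))) X' w' h.
rewrite /L; under eq_integral => t _.
  rewrite (_ : _ * _ = w t * expR (- (a * X t)) * expR (h * - X t)); last first.
    by rewrite -mulrA -expRD; congr (_ * expR _); ring.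
  over.
rewrite main//.
- under eq_integral do rewrite e1.
  rewrite Ew'// -mulrA -powRM ?ltW//; congr (K * _ `^ _)%:E.
  by rewrite /W; field; rewrite gt_eqF.
- exact: measurable_funN.
- exact: measurable_weighted_exp.
- by move=> t; rewrite weighted_exp_ge0.
- exact: measurable_funM.
- by move=> n; exact: moment_integrable (Lfin) _ _ hua.
- move=> n; under eq_fun do rewrite X'n EFinM.
  exact: integrableZl.
- move=> n; rewrite (momentE mX mw w0 Lfin AB0 LE n hua).
  under [RHS]eq_Rintegral do rewrite X'n.
  rewrite [RHS]RintegralZl; [|exact: measurableT|exact: iw'].
  have -> : (\int[mu]_t (gamma_weight (lam + n%:R) t * expR (- (1 * t))) =
      Gamma_fun (lam + n%:R))%R.
    by rewrite /Rintegral gamma_weight_integral ?ltr_wpDr//= powR1 mulr1.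
  rewrite Gamma_funD// /c -/W powRD; last by rewrite (gt_eqF W0) implybT.
  rewrite powR_invn ?ltW//.
  by rewrite -mulNr exprMn exprVn; field; rewrite ?expf_neq0 ?gt_eqF.
- under eq_integral do rewrite mulrDr e1 e2 EFinD.
  rewrite ge0_integralD// ?Ew'// ?ltry//.
  + by move=> t _; rewrite lee_fin mulr_ge0// mulr_ge0 ?expR_ge0//
    gamma_weight_ge0.
  + by apply/measurable_EFinP/measurable_funM => //;
    apply: measurable_weighted_exp => //;
      exact: measurable_gamma_weight.
  + by move=> t _; rewrite lee_fin mulr_ge0// mulr_ge0 ?expR_ge0//
    gamma_weight_ge0.
  + by apply/measurable_EFinP/measurable_funM => //;
    apply: measurable_weighted_exp => //;
      exact: measurable_gamma_weight.
Qed.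

Variables (u v a : R).
Hypothesis AB0 : forall th, u < th < v -> 0 < A + B * th.
Hypothesis LE : forall th,
  u < th < v -> L th = (K * (A + B * th) `^ (- lam))%:E.
Hypothesis hua : u < a < v.

Let good (th : R) := 0 < A + B * th /\ exists2 e : R, 0 < e &
  forall th', `|th' - th| < e -> 0 < A + B * th' /\
    L th' = (K * (A + B * th') `^ (- lam))%:E.

Let good_step (th th' : R) :
  good th -> `|B * (th' - th)| < A + B * th -> good th'.
Proof.
move=> [W0 [e e0 he]] h.
have he' x : th - e < x < th + e -> 0 < A + B * x /\
    L x = (K * (A + B * x) `^ (- lam))%:E.
  by move=> hx; apply: he; rewrite ltr_distl.
have step x : `|B * (x - th)| < A + B * th -> 0 < A + B * x /\
    L x = (K * (A + B * x) `^ (- lam))%:E.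
  move=> hx; split.
    by move: hx; rewrite ltr_norml => /andP[+ _]; lra.
  have := @gamma_line_step (th - e) (th + e) th (x - th) _ _ _ hx.
  rewrite subrKC; apply.
  - by move=> y /he'[].
  - by move=> y /he'[].
  - by rewrite ltrBlDr !ltrDl e0.
split; first by have [] := step _ h.
(* The slack in the strict inequality, divided by [|B| + 1], is a radius around [th'] that stays
   within reach of [th]; the added 1 covers [B = 0]. *)
have B1 : 0 < `|B| + 1 by rewrite ltr_wpDl.
exists ((A + B * th - `|B * (th' - th)|) / (`|B| + 1)).
  by rewrite divr_gt0 ?subr_gt0.
move=> x; rewrite ltr_pdivlMr// => hx; apply: step.
have -> : B * (x - th) = B * (x - th') + B * (th' - th) by ring.
apply: le_lt_trans (ler_normD _ _) _; rewrite -ltrBrDr.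
apply: le_lt_trans hx; rewrite normrM mulrC ler_wpM2l// lerDl.
exact: ler01.
Qed.

Lemma gamma_line th : 0 < A + B * th -> L th = (K * (A + B * th) `^ (- lam))%:E.
Proof.
have good_a : good a.
  split; first exact: AB0.
  move: (hua) => /andP[ua av].
  exists (Num.min (a - u) (v - a)); first by rewrite lt_min !subr_gt0 ua av.
  move=> x; rewrite lt_min => /andP[h1 h2].
  have hx : u < x < v.
    apply/andP; split.
      by move: h1; rewrite ltr_distl => /andP[+ _]; lra.
    by move: h2; rewrite ltr_distl => /andP[_]; lra.
  by split; [exact: AB0|exact: LE].
(* One step from a good point with value W reaches all points with value strictly between 0 and 2 W,
   so [n] doublings give this range. *)
suff goodW n x : 0 < A + B * x < 2 ^+ n * (A + B * a) -> good x.
  move=> Wth.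
  have W0 : 0 < A + B * a := AB0 hua.
  suff [_ [e e0 he]] : good th by have [] := he th; rewrite ?subrr ?normr0.
  apply: (goodW (Num.truncn ((A + B * th) / (A + B * a))).+1).
  rewrite Wth/= -ltr_pdivrMr//.
  apply: lt_trans (truncnS_gt _) _.
  by rewrite -natrX ltr_nat ltn_expl.
elim: n x => [|n IH] x /andP[x0 hx].
  apply: good_step good_a _; move: hx; rewrite expr0 mul1r => hx.
  by rewrite ltr_norml; apply/andP; split; lra.
have [B0|Bn0] := eqVneq B 0.
  apply: good_step good_a _; rewrite B0 mul0r normr0.
  by have := AB0 hua; rewrite B0.
(* A value strictly between half the target value and the bound of the induction hypothesis: the
   point where it is taken is good, and [x] is within one step of it. *)
pose y := ((A + B * x) / 2 + 2 ^+ n * (A + B * a)) / 2.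
have yE : A + B * ((y - A) / B) = y by field.
move: hx; rewrite exprS -mulrA => hx.
apply: (@good_step ((y - A) / B)).
  by apply: IH; rewrite yE /y; apply/andP; split; lra.
rewrite yE (_ : B * _ = A + B * x - y); last by field.
by rewrite ltr_norml /y; apply/andP; split; lra.
Qed.

End gamma_line.

(** * Continuation along coordinate lines *)

Section continuation.
Context {R : realType} (lam : R).
Implicit Types (P : R -> R -> R -> R) (L : R -> R -> R -> \bar R).

Definition agree P L (a b c : R) := 0 < P a b c /\ exists2 e : R, 0 < e &
  forall a' b' c', `|a' - a| < e -> `|b' - b| < e -> `|c' - c| < e ->
    0 < P a' b' c' /\ L a' b' c' = (P a' b' c' `^ (- lam))%:E.

Definition open_pos P := forall a b c, 0 < P a b c -> exists2 e : R, 0 < e &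
  forall a' b' c', `|a' - a| < e -> `|b' - b| < e -> `|c' - c| < e ->
    0 < P a' b' c'.

(** Stated for the first variable only; the other two are treated by permuting the arguments of [P]
    and [L]. *)
Definition line_continuation P L := forall u v a b c,
  (forall y, u < y < v -> 0 < P y b c /\ L y b c = (P y b c `^ (- lam))%:E) ->
  u < a < v -> forall x, 0 < P x b c -> L x b c = (P x b c `^ (- lam))%:E.

Lemma agreeE P L a b c : agree P L a b c -> L a b c = (P a b c `^ (- lam))%:E.
Proof.
move=> [_ [e e0 he]]; suff [] :
  0 < P a b c /\ L a b c = (P a b c `^ (- lam))%:E by [].
by apply: he; rewrite subrr normr0.
Qed.

(** Every line parallel to the axis and close to the given one still crosses the cube where the
    formula is known, so a whole neighbourhood is carried to the new point. *)
Lemma agree_move P L a b c x : open_pos P -> line_continuation P L ->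
  agree P L a b c -> 0 < P x b c -> agree P L x b c.
Proof.
move=> oP lP [Pabc [e e0 he]] Px; split=> //.
have [e' e'0 he'] := oP _ _ _ Px.
exists (Num.min e e'); first by rewrite lt_min e0.
move=> a' b' c'; rewrite !lt_min => /andP[a1 a2] /andP[b1 b2] /andP[c1 c2].
split; first exact: he'.
apply: (lP (a - e) (a + e) a); last exact: he'.
- by move=> y; rewrite -ltr_distl => ya; exact: he.
- by rewrite ltrBlDr !ltrDl e0.
Qed.

Variables (P : R -> R -> R -> R) (L : R -> R -> R -> \bar R).
Hypothesis lam0 : 0 < lam.
Hypothesis oP : open_pos P.
Hypothesis l1 : line_continuation P L.
Hypothesis l2 : line_continuation (fun b a c => P a b c) (fun b a c => L a b c).
Hypothesis l3 : line_continuation (fun c a b => P a b c) (fun c a b => L a b c).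

Let move1 a b c x : agree P L a b c -> 0 < P x b c -> agree P L x b c.
Proof. exact: agree_move. Qed.

Let move2 a b c x : agree P L a b c -> 0 < P a x c -> agree P L a x c.
Proof.
move=> [h [e e0 he]] Px.
have oP2 : open_pos (fun b a c => P a b c).
  by move=> ? ? ? /oP[e1 e10 he1]; exists e1 => // *; exact: he1.
have [] := @agree_move (fun b a c => P a b c) (fun b a c => L a b c)
  b a c x oP2 l2 _ Px.
  by split=> //; exists e => // *; exact: he.
by move=> _ [e1 e10 he1]; split=> //; exists e1 => // *; exact: he1.
Qed.

Let move3 a b c x : agree P L a b c -> 0 < P a b x -> agree P L a b x.
Proof.
move=> [h [e e0 he]] Px.
have oP3 : open_pos (fun c a b => P a b c).
  by move=> ? ? ? /oP[e1 e10 he1]; exists e1 => // *; exact: he1.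
have [] := @agree_move (fun c a b => P a b c) (fun c a b => L a b c)
  c a b x oP3 l3 _ Px.
  by split=> //; exists e => // *; exact: he.
by move=> _ [e1 e10 he1]; split=> //; exists e1 => // *; exact: he1.
Qed.

(* The bound M on L keeps P away from 0 along the segment. *)
Lemma agree_segment (a b c M : R) :
  (forall t, 0 <= t <= 1 -> (L (t * a) (t * b) (t * c) <= M%:E)%E) ->
  continuous (fun t : R => P (t * a) (t * b) (t * c)) ->
  agree P L a b c -> agree P L 0 0 0.
Proof.
move=> LM cP ag.
pose g t := agree P L (t * a) (t * b) (t * c).
(* Continuity argument: the formula holds from [t] up to the endpoint 1, and the infimum of such [t]
   is shown to be 0. *)
pose T := [set t : R | 0 <= t <= 1 /\ forall s, t <= s <= 1 -> g s].
have T1 : T 1.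
  split; first by rewrite ler01 lexx.
  by move=> s; rewrite -eq_le => /eqP <-; rewrite /g !mul1r.
have hT : has_inf T by split; [exists 1|exists 0 => t [/andP[]]].
pose t0 := inf T.
have t00 : 0 <= t0 by apply: lb_le_inf; [exists 1|move=> t [/andP[]]].
have t01 : t0 <= 1 by apply: ge_inf => //; case: hT.
have M0 : 0 < M.
  have := LM 1; rewrite ler01 lexx !mul1r => /(_ erefl).
  rewrite (agreeE ag) lee_fin; apply: lt_le_trans.
  by rewrite powR_gt0//; exact: ag.1.
(* Where the formula holds, P^-lam <= M, that is P >= M^(-1/lam); by continuity [P] cannot vanish at
   the infimum. *)
pose kap := M `^ (- lam^-1).
have kap0 : 0 < kap by rewrite powR_gt0.
have gk t : 0 <= t <= 1 -> g t -> kap <= P (t * a) (t * b) (t * c).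
  move=> ht gt; have := LM t ht; have P0 := gt.1.
  rewrite (agreeE gt) lee_fin => h.
  have Vl : 0 < lam^-1 by rewrite invr_gt0.
  have := @ge0_ler_powR _ lam^-1 (ltW Vl) _ _ _ _ h.
  rewrite !nnegrE powR_ge0 (ltW M0) => /(_ erefl erefl).
  rewrite -powRrM mulNr mulfV ?gt_eqF// powRN powRr1 ?(ltW P0)// => h'.
  by rewrite /kap powRN invf_ple ?posrE// powR_gt0.
have near_t0 (e : R) : 0 < e -> exists2 t, T t & t0 <= t < t0 + e.
  move=> e0; have [t Tt ht] := inf_adherent e0 hT; exists t => //.
  by rewrite ht andbT; apply: ge_inf => //; case: hT.
have P0 : 0 < P (t0 * a) (t0 * b) (t0 * c).
  apply: lt_le_trans kap0 _; rewrite leNgt; apply/negP => Pk.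
  have /nbhs_ballP[e /= e0 he] : \forall t \near t0,
    P (t * a) (t * b) (t * c) < kap.
    exact: cvgr_lt (cP t0) _ Pk.
  have [t [t1 Tt] /andP[tt0 tt1]] := near_t0 _ e0.
  have : P (t * a) (t * b) (t * c) < kap.
    by apply: he; rewrite /ball/= distrC ger0_norm ?subr_ge0// ltrBlDl.
  rewrite ltNge gk//; apply: Tt; rewrite lexx/=.
  by case/andP: t1.
have [e e0 he] := oP P0.
(* [S] dominates the three coordinates, so moving [t] by less than [e / S] keeps each coordinate of
   the point within [e], inside the cube where [P] is positive. *)
pose S := `|a| + `|b| + `|c| + 1.
have S0 : 0 < S by rewrite ltr_wpDl// !addr_ge0.
have hS t z : `|z| <= S -> `|t - t0| < e / S -> `|t * z - t0 * z| < e.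
  move=> zS; rewrite ltr_pdivlMr// => h.
  by apply: le_lt_trans h; rewrite -mulrBl normrM ler_wpM2l.
have aS : `|a| <= S.
  by rewrite /S -!addrA lerDl !addr_ge0.
have bS : `|b| <= S.
  by rewrite /S [`|a| + _]addrC -!addrA lerDl !addr_ge0.
have cS : `|c| <= S.
  by rewrite /S [_ + `|c|]addrC -!addrA lerDl !addr_ge0.
have eS0 : 0 < e / S by rewrite divr_gt0.
have gt t : `|t - t0| < e / S -> g t.
  have [t1 [t1i Tt1] /andP[tt0 tt1]] := near_t0 _ eS0.
  have g1 : g t1 by apply: Tt1; rewrite lexx/=; case/andP: t1i.
  have t1S : `|t1 - t0| < e / S by rewrite ger0_norm ?subr_ge0// ltrBlDl.
  move=> tS.
  (* The points for [t1] and [t] are joined by three moves parallel to the axes; the corners stay in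
     the cube of positivity. *)
  apply: (@move3 _ _ (t1 * c)); last by apply: he; exact: hS.
  apply: (@move2 _ (t1 * b)); last by apply: he; exact: hS.
  by apply: (@move1 (t1 * a)) => //; apply: he; exact: hS.
have Tt t : t0 - e / S < t -> 0 <= t <= 1 -> T t.
  move=> tt0 ht; split=> // s /andP[ts s1].
  have [st0|st0] := ltP s (t0 + e / S).
    apply: gt; rewrite ltr_distl st0 andbT; exact: lt_le_trans ts.
  have [t1 [_ Tt1] /andP[_ tt1]] := near_t0 _ eS0.
  by apply: Tt1; rewrite s1 andbT (le_trans (ltW tt1)).
have t0E : t0 = 0.
  apply/eqP; rewrite eq_le t00 andbT leNgt; apply/negP => t0p.
  (* If [t0] were positive this would be a smaller element of [T]. *)
  pose t1 := Num.max 0 (t0 - e / S / 2).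
  have : T t1.
    apply: Tt.
      by rewrite lt_max; apply/orP; right; lra.
    rewrite le_max lexx/= ge_max ler01/=.
    by lra.
  move=> /(ge_inf (proj2 hT)); rewrite -/t0 le_max => /orP[|]; lra.
have : g t0 by apply: gt; rewrite subrr normr0.
by rewrite /g t0E !mul0r.
Qed.

(** A path of three axis-parallel moves from the origin never leaves the orthant, where [P] is
    positive. *)
Lemma agree_orthant : (forall a b c,
  0 <= a -> 0 <= b -> 0 <= c -> 0 < P a b c) ->
  agree P L 0 0 0 -> forall a b c, 0 <= a -> 0 <= b -> 0 <= c ->
  L a b c = (P a b c `^ (- lam))%:E.
Proof.
move=> Pp ag a b c a0 b0 c0.
apply: agreeE.
  apply: (@move3 _ _ 0); last exact: Pp.
  apply: (@move2 _ 0); last exact: Pp.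
  by apply: (@move1 0); last exact: Pp.
Qed.

End continuation.

Section coordinates.
Context {R : realType}.

Lemma measurable_coord1 : measurable_fun setT (fun x : mR3 R => x.1.1 : R).
Proof. exact: measurableT_comp measurable_fst measurable_fst. Qed.

Lemma measurable_coord2 : measurable_fun setT (fun x : mR3 R => x.1.2 : R).
Proof. exact: measurableT_comp measurable_snd measurable_fst. Qed.

Lemma measurable_coord3 : measurable_fun setT (fun x : mR3 R => x.2 : R).
Proof. exact: measurable_snd. Qed.

Lemma measurable_expRN3 (a b c : R) : measurable_fun setT
  (fun x : mR3 R => expR (- (a * x.1.1 + b * x.1.2 + c * x.2))).
Proof.
apply: measurableT_comp => //; apply: measurable_funN.
apply: measurable_funD; last exact: (measurable_funM (measurable_cst c)
  measurable_coord3).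
by apply: measurable_funD; apply: measurable_funM => //;
  [exact: measurable_coord1|exact: measurable_coord2].
Qed.

End coordinates.

(** * Continuation for the affine multilinear polynomial *)

Section multilinear_laplace.
Context {R : realType}.
Variables (lam p1 p2 p3 p12 p13 p23 p123 : R).
Hypothesis lam0 : 0 < lam.
Hypotheses (p1_gt0 : 0 < p1) (p2_gt0 : 0 < p2) (p3_gt0 : 0 < p3).
Hypotheses (p12_gt0 : 0 < p12) (p13_gt0 : 0 < p13) (p23_gt0 : 0 < p23).
Hypothesis p123_gt0 : 0 < p123.

Definition multilinear3 (th : R * R * R) : R :=
  1 + p1 * th.1.1 + p2 * th.1.2 + p3 * th.2
    + p12 * (th.1.1 * th.1.2) + p13 * (th.1.1 * th.2)
    + p23 * (th.1.2 * th.2) + p123 * (th.1.1 * th.1.2 * th.2).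

Let P a b c := multilinear3 (a, b, c).

Lemma multilinear3_ge1 a b c : 0 <= a -> 0 <= b -> 0 <= c -> 1 <= P a b c.
Proof.
move=> a0 b0 c0; rewrite /P /multilinear3/= -!addrA lerDl.
by rewrite !addr_ge0// !mulr_ge0// ltW.
Qed.

Lemma continuous_multilinear3 : continuous multilinear3.
Proof.
have c1 : continuous (fun th : R * R * R => th.1.1).
  by move=> th; apply: (@cvg_comp _ _ _ (fst : R * R * R -> R * R) (fst :
    R * R -> R));
    exact: cvg_fst.
have c2 : continuous (fun th : R * R * R => th.1.2).
  by move=> th; apply: (@cvg_comp _ _ _ (fst : R * R * R -> R * R) (snd :
    R * R -> R));
    [exact: cvg_fst|exact: cvg_snd].
have c3 : continuous (fun th : R * R * R => th.2) by move=> th; exact: cvg_snd.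
have D (f g : R * R * R -> R) : continuous f -> continuous g ->
    continuous (fun th => f th + g th).
  by move=> cf cg th; apply: cvgD; [exact: cf|exact: cg].
have M (f g : R * R * R -> R) : continuous f -> continuous g ->
    continuous (fun th => f th * g th).
  by move=> cf cg th; apply: cvgM; [exact: cf|exact: cg].
have C (k : R) : continuous (fun _ : R * R * R => k) by exact: cst_continuous.
exact: (D _ _ (D _ _ (D _ _ (D _ _ (D _ _ (D _ _ (D _ _ (C 1) (M _ _ (C p1) c1))
  (M _ _ (C p2) c2)) (M _ _ (C p3) c3)) (M _ _ (C p12) (M _ _ c1 c2)))
  (M _ _ (C p13) (M _ _ c1 c3))) (M _ _ (C p23) (M _ _ c2 c3)))
  (M _ _ (C p123) (M _ _ (M _ _ c1 c2) c3))).
Qed.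

Lemma nbhs_cube (Q : set (R * R * R)) (a b c : R) : nbhs (a, b, c) Q ->
  exists2 e : R, 0 < e & forall a' b' c', `|a' - a| < e -> `|b' - b| < e ->
    `|c' - c| < e -> Q (a', b', c').
Proof.
move=> /nbhs_ballP[e /= e0 he]; exists e => // a' b' c' ha hb hc.
by apply: he; split => /=; [split|]; rewrite /ball/= distrC.
Qed.

Let oP : open_pos P.
Proof.
move=> a b c Pabc.
have /nbhs_cube[e e0 he] : \forall th \near (a, b, c), 0 < multilinear3 th.
  by apply: (cvgr_gt _ (@continuous_multilinear3 (a, b, c))).
by exists e.
Qed.

Variable nu : {measure set (mR3 R) -> \bar R}.
Let L a b c := laplace3 nu (a, b, c).

(** The two frozen coordinates go into the weight [w], which gives an instance of [gamma_line] with
    [K = 1]; [X], [Y], [Z] are the coordinates in any order. *)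
Let line (X Y Z : mR3 R -> R) (b c A B : R) (l : R -> \bar R) (u v a : R) :
  measurable_fun setT X -> measurable_fun setT Y -> measurable_fun setT Z ->
  (forall a, l a = \int[nu]_x (expR (- (a * X x + b * Y x + c * Z x)))%:E)%E ->
  (forall y, u < y < v -> 0 < A + B * y /\ l y = ((A + B * y) `^ (- lam))%:E) ->
  u < a < v -> forall x, 0 < A + B * x -> l x = ((A + B * x) `^ (- lam))%:E.
Proof.
move=> mX mY mZ lE h hua x hx.
pose w t := expR (- (b * Y t + c * Z t)).
have mw : measurable_fun setT w.
  apply: measurableT_comp => //; apply: measurable_funN.
  by apply: measurable_funD; exact: measurable_funM.
have w0 t : 0 <= w t by exact: expR_ge0.
have lE' y : l y = (\int[nu]_t (w t * expR (- (y * X t)))%:E)%E.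
  rewrite lE; apply: eq_integral => t _; rewrite /w -expRD; congr (expR _)%:E;
    ring.
have := @gamma_line _ _ _ nu X w mX mw w0 1 A B lam ler01 lam0 u v a _ _ hua x
  hx.
rewrite -lE' mul1r; apply.
- by move=> y /h[].
- by move=> y /h[_ hy]; rewrite mul1r -hy lE'.
Qed.

Let l1 : line_continuation lam P L.
Proof.
move=> u v a b c h hua x hx.
pose A := P 0 b c; pose B := P 1 b c - P 0 b c.
have E y : P y b c = A + B * y by rewrite /A /B /P /multilinear3/=; ring.
move: hx; rewrite E => hx.
apply: (@line _ _ _ b c A B (fun y =>
  L y b c) u v a measurable_coord1 measurable_coord2 measurable_coord3) => //.
by move=> y /h; rewrite E.
Qed.

Let l2 : line_continuation lam (fun b a c => P a b c) (fun b a c => L a b c).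
Proof.
move=> u v b a c h hua x hx.
pose A := P a 0 c; pose B := P a 1 c - P a 0 c.
have E y : P a y c = A + B * y by rewrite /A /B /P /multilinear3/=; ring.
move: hx; rewrite E => hx.
apply: (@line _ _ _ a c A B (fun y =>
  L a y c) u v b measurable_coord2 measurable_coord1 measurable_coord3 _ _ hua
    x hx).
  move=> y; rewrite /L /laplace3/=; apply: eq_integral => t _.
  by rewrite [in RHS](addrC (y * _)).
by move=> y /h; rewrite E.
Qed.

Let l3 : line_continuation lam (fun c a b => P a b c) (fun c a b => L a b c).
Proof.
move=> u v c a b h hua x hx.
pose A := P a b 0; pose B := P a b 1 - P a b 0.
have E y : P a b y = A + B * y by rewrite /A /B /P /multilinear3/=; ring.
move: hx; rewrite E => hx.
apply: (@line _ _ _ a b A B (fun y =>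
  L a b y) u v c measurable_coord3 measurable_coord1 measurable_coord2 _ _ hua
    x hx).
  move=> y; rewrite /L /laplace3/=; apply: eq_integral => t _.
  by rewrite -[in RHS]addrA [in RHS](addrC (y * _)).
by move=> y /h; rewrite E.
Qed.

(** An interior point of the given set is joined to the origin by a segment, which may leave {P > 0}
    as far as is known beforehand; boundedness of the transform rules this out. *)
Lemma has_laplace3_orthant : nu setT = 1%E ->
  has_laplace3 nu [set th | 0 < multilinear3 th] (fun th =>
    multilinear3 th `^ (- lam)) ->
  forall a b c, 0 <= a -> 0 <= b -> 0 <= c ->
    laplace3 nu (a, b, c) = (multilinear3 (a, b, c) `^ (- lam))%:E.
Proof.
move=> nu1 [Th [[[[a b] c] /nbhs_cube[e e0 he]] ThP ThE]].
have ag : agree lam P L a b c.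
  have in_Th a' b' c' : Th (a', b', c') -> 0 < P a' b' c' /\
      L a' b' c' = (P a' b' c' `^ (- lam))%:E.
    by move=> h; split; [exact: ThP|exact: ThE].
  split; first by apply: ThP; apply: he; rewrite subrr normr0.
  by exists e => // a' b' c' ha hb hc; apply: in_Th; exact: he.
apply: (agree_orthant oP l1 l2 l3).
  by move=> x y z x0 y0 z0; apply: lt_le_trans (multilinear3_ge1 x0 y0 z0).
apply: (agree_segment lam0 oP l1 l2 l3 (M := 1 + P a b c `^ (- lam)) _ _ ag).
- move=> t /andP[t0 t1].
  (* For [t] in [0, 1] the exponential of - t s is at most 1 if s >= 0 and at most that of - s if s
     < 0. Integration, with total mass one, bounds the transform on the segment. *)
  have hp (x : mR3 R) : expR (- (t * a * x.1.1 + t * b * x.1.2 +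
    t * c * x.2)) <=
      1 + expR (- (a * x.1.1 + b * x.1.2 + c * x.2)).
    set s := a * x.1.1 + b * x.1.2 + c * x.2.
    have -> : t * a * x.1.1 + t * b * x.1.2 +
      t * c * x.2 = t * s by rewrite /s; ring.
    have [s0|s0] := leP 0 s.
      by rewrite ler_wpDr ?expR_ge0// expR_le1 oppr_le0 mulr_ge0.
    rewrite ler_wpDl// ler_expR lerN2.
    by rewrite -[leLHS]mul1r ler_wnM2r// ltW.
  have -> : (1 + P a b c `^ (- lam))%:E =
      (\int[nu]_x (1 + expR (- (a * x.1.1 + b * x.1.2 + c * x.2)))%:E)%E.
    under eq_integral do rewrite EFinD.
    rewrite ge0_integralD//; last first.
      by apply/measurable_EFinP; exact: measurable_expRN3.
    by rewrite integral_cst// nu1 mul1e EFinD -(agreeE ag).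
  apply: ge0_le_integral => //.
  - by apply/measurable_EFinP; exact: measurable_expRN3.
  - by apply/measurable_EFinP; apply: measurable_funD => //;
    exact: measurable_expRN3.
  - by move=> x _; rewrite lee_fin.
- have ct (z : R) : continuous (fun t : R => t * z).
    by move=> t; apply: cvgM; [exact: cvg_id|exact: cvg_cst].
  move=> t.
  apply: (@cvg_comp _ _ _ (fun t : R => (t * a, t * b, t * c)) multilinear3 _
    (nbhs (t * a, t * b, t * c))); last exact: continuous_multilinear3.
  exact: (cvg_pair (cvg_pair (ct a t) (ct b t)) (ct c t)).
Qed.

End multilinear_laplace.

(** * Uniqueness of the Laplace transform on the orthant *)

Section boxes.
Context {R : realType}.

Definition box3 (c : R * R * R) : set (mR3 R) :=
  [set x | [/\ c.1.1 < x.1.1, c.1.2 < x.1.2 & c.2 < x.2]].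

Definition boxes3 : set (set (mR3 R)) := range box3.

Lemma box3E c : box3 c = (`]c.1.1, +oo[ `*` `]c.1.2, +oo[) `*` `]c.2, +oo[.
Proof.
apply/seteqP; split=> -[[x1 x2] x3]; rewrite /box3 /= !in_itv/= !andbT.
  by case.
by case=> -[].
Qed.

Lemma measurable_box3 c : measurable (box3 c).
Proof.
by rewrite box3E; apply: measurableX; [apply: measurableX|];
  exact: measurable_itv.
Qed.

Lemma box3I c c' : box3 c `&` box3 c' =
  box3 (Num.max c.1.1 c'.1.1, Num.max c.1.2 c'.1.2, Num.max c.2 c'.2).
Proof.
apply/seteqP; split=> x; rewrite /box3/= !gt_max.
  by move=> [[-> -> ->] [-> -> ->]].
by move=> [/andP[-> ->] /andP[-> ->] /andP[-> ->]].
Qed.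

Lemma exists_nat_gtN3 (x y z : R) :
  exists n : nat, [/\ - n%:R < x, - n%:R < y & - n%:R < z].
Proof.
exists (Num.truncn (`|x| + `|y| + `|z|)).+1.
have := truncnS_gt (`|x| + `|y| + `|z|); set N := _%:R => hN.
have [hx hy hz] : [/\ - x <= `|x|, - y <= `|y| & - z <= `|z|].
  by split; rewrite -normrN ler_norm.
have [nx ny nz] : [/\ 0 <= `|x|, 0 <= `|y| & 0 <= `|z|] by split.
by split; lra.
Qed.

(** A half-space in one coordinate is a countable union of boxes whose other two corners go to minus
    infinity; hence the coordinates, and so the identity map, are measurable for the generated
    sigma-algebra. *)
Lemma measurable_boxes3 (A : set (mR3 R)) : measurable A -> <<s boxes3 >> A.
Proof.
pose T := g_sigma_algebraType boxes3.
have bT c : measurable (box3 c : set T) by apply: sub_sigma_algebra; exists c.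
have m1 : measurable_fun setT (fun x : T => x.1.1 : measurableTypeR R).
  apply: (measurability _ (RGenOInfty.measurableE R)) => _ [_ [c ->] <-].
  rewrite setTI (_ : _ @^-1` _ = \bigcup_n box3 (c, - n%:R, - n%:R)).
    by apply: bigcupT_measurable => n; exact: bT.
  apply/seteqP; split=> [[[x y] z]|[[x y] z] [n _ []]];
    rewrite /= in_itv/= andbT//.
  have [n [_ hy hz]] := exists_nat_gtN3 x y z.
  by move=> cx; exists n.
have m2 : measurable_fun setT (fun x : T => x.1.2 : measurableTypeR R).
  apply: (measurability _ (RGenOInfty.measurableE R)) => _ [_ [c ->] <-].
  rewrite setTI (_ : _ @^-1` _ = \bigcup_n box3 (- n%:R, c, - n%:R)).
    by apply: bigcupT_measurable => n; exact: bT.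
  apply/seteqP; split=> [[[x y] z]|[[x y] z] [n _ []]];
    rewrite /= in_itv/= andbT//.
  have [n [hx _ hz]] := exists_nat_gtN3 x y z.
  by move=> cx; exists n.
have m3 : measurable_fun setT (fun x : T => x.2 : measurableTypeR R).
  apply: (measurability _ (RGenOInfty.measurableE R)) => _ [_ [c ->] <-].
  rewrite setTI (_ : _ @^-1` _ = \bigcup_n box3 (- n%:R, - n%:R, c)).
    by apply: bigcupT_measurable => n; exact: bT.
  apply/seteqP; split=> [[[x y] z]|[[x y] z] [n _ []]];
    rewrite /= in_itv/= andbT//.
  have [n [hx hy _]] := exists_nat_gtN3 x y z.
  by move=> cx; exists n.
have mid : measurable_fun setT (fun x : T => (x.1.1, x.1.2, x.2) : mR3 R).
  by apply: measurable_fun_pair => //; apply: measurable_fun_pair.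
move=> mA; have := mid measurableT A mA.
rewrite setTI (_ : _ @^-1` A = A)//.
by apply/seteqP; split=> -[[x y] z].
Qed.

Lemma measure_unique_boxes3 (m1 m2 : {measure set (mR3 R) -> \bar R}) :
  (forall c, (m1 (box3 c) < +oo)%E) -> (forall c, m1 (box3 c) = m2 (box3 c)) ->
  forall A, measurable A -> m1 A = m2 A.
Proof.
move=> m1oo m12 A mA.
apply: (@g_sigma_algebra_measure_unique _ R _ boxes3 _
  (fun n => box3 (- n%:R, - n%:R, - n%:R)) _ _ m1 m2) => //.
- by move=> _ [c _ <-]; exact: measurable_box3.
- by move=> n; exists (- n%:R, - n%:R, - n%:R).
- apply/seteqP; split=> // -[[x y] z] _.
  have [n [hx hy hz]] := exists_nat_gtN3 x y z.
  by exists n.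
- by move=> _ _ [c _ <-] [c' _ <-]; rewrite box3I; eexists.
- by move=> _ [c _ <-].
- exact: measurable_boxes3.
Qed.

End boxes.

(** A smooth approximation of the indicator of {d < 0}. The outer factor [n] decides the boundary
    case: at [d = 0] the limit is 0, in accordance with the strict inequalities of [box3]. *)
Lemma cvg_double_exp (R : realType) (d : R) :
  expR (- (n%:R * expR (n%:R * d))) @[n --> \oo] --> ((d < 0)%R%:R : R).
Proof.
have [d0|d0] := ltP d 0.
  rewrite /= mulr1n -[X in _ --> X]expR0; apply: continuous_cvg;
    first exact: continuous_expR.
  rewrite -[X in _ --> X]oppr0; apply: cvgN.
  have d2 : 0 < d ^+ 2 by rewrite exprn_even_gt0//= lt_eqF.
  (* From (n |d|)^2 <= 2 exp (n |d|) one gets n exp (n d) <= 2 / (n d^2), and 2 / n <= 4 / (n +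
     1). *)
  apply: (@squeeze_cvgr _ _ _ _ (cst 0) (fun n : nat =>
    4 / d ^+ 2 * n.+1%:R^-1)).
  - near=> n; have n0 : (0 < n)%N by near: n; exists 1%N.
    have n0R : 0 < n%:R :> R by rewrite ltr0n.
    rewrite mulr_ge0 ?expR_ge0//=.
    have nd : 0 <= n%:R * - d by rewrite mulr_ge0// oppr_ge0 ltW.
    have := exprn_le_expR 2 nd.
    rewrite mulrN expRN.
    have e0 : 0 < expR (n%:R * d) by exact: expR_gt0.
    rewrite sqrrN exprMn => h.
    have h' : n%:R ^+ 2 * d ^+ 2 * expR (n%:R * d) <= 2.
      by rewrite -ler_pdivlMr.
    rewrite -ler_pdivrMr ?invr_gt0// invrK.
    rewrite ler_pdivlMr//.
    apply: (@le_trans _ _ (2 * (n%:R ^+ 2 * d ^+ 2 * expR (n%:R * d))));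
      last by lra.
    have -> : 2 * (n%:R ^+ 2 * d ^+ 2 * expR (n%:R * d)) =
      n%:R * expR (n%:R * d) * (2 * n%:R) * d ^+ 2 by ring.
    rewrite ler_pM2r// ler_pM2l ?mulr_gt0//.
    by rewrite -natrM ler_nat mul2n -addnn -[n.+1]addn1 leq_add2l.
  - exact: cvg_cst.
  - rewrite -[X in _ --> X](mulr0 (4 / d ^+ 2)); apply: cvgM;
    first exact: cvg_cst.
    exact: cvg_harmonic.
rewrite /= mulr0n.
apply: (@squeeze_cvgr _ _ _ _ (cst 0) (fun n : nat => expR (- n%:R))).
- near=> n; rewrite expR_ge0/= ler_expR lerN2 -[leLHS]mulr1 ler_wpM2l//.
  by rewrite -expR0 ler_expR mulr_ge0.
- exact: cvg_cst.
- exact: cvgn_expR.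
Unshelve. all: by end_near. Qed.

(** * From the transform on the orthant to the law *)

Section laplace_unique.
Context {R : realType}.
Variables m1 m2 : probability (mR3 R) R.
Hypothesis L12 : forall a b c : R, 0 <= a -> 0 <= b -> 0 <= c ->
  laplace3 m1 (a, b, c) = laplace3 m2 (a, b, c).
Hypothesis L1 : forall a b c : R, 0 <= a -> 0 <= b -> 0 <= c ->
  (laplace3 m1 (a, b, c) <= 1)%E.

Section exponential_polynomial.
Variables (s w1 w2 w3 : R).
Hypotheses (s0 : 0 <= s) (w10 : 0 <= w1) (w20 : 0 <= w2) (w30 : 0 <= w3).

Let S (x : mR3 R) : R := w1 * expR (- (s * x.1.1)) + w2 * expR (- (s * x.1.2))
  + w3 * expR (- (s * x.2)).

Let E (a b c : R) (x : mR3 R) : R := expR (- (a * x.1.1 + b * x.1.2 + c * x.2)).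

Let mE a b c : measurable_fun setT (E a b c) := measurable_expRN3 a b c.

Let SE x : S x = w1 * E s 0 0 x + w2 * E 0 s 0 x + w3 * E 0 0 s x.
Proof. by rewrite /S /E !mul0r !addr0 !add0r. Qed.

Let mS : measurable_fun setT S.
Proof.
rewrite (_ : S = fun x => w1 * E s 0 0 x + w2 * E 0 s 0 x + w3 * E 0 0 s x).
  by do 2?apply: measurable_funD; exact: measurable_funM.
by apply/funext => x; exact: SE.
Qed.

Let S0 x : 0 <= S x.
Proof. by rewrite !addr_ge0// mulr_ge0// expR_ge0. Qed.

(** Splitting off one factor [S] shifts one of [a], [b], [c] by [s], so iteration expresses the
    integral through transform values on the orthant. *)
Let ES k a b c (m : probability (mR3 R) R) :
  (\int[m]_x (E a b c x * S x ^+ k.+1)%:E =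
   w1%:E * \int[m]_x (E (a + s) b c x * S x ^+ k)%:E +
   w2%:E * \int[m]_x (E a (b + s) c x * S x ^+ k)%:E +
   w3%:E * \int[m]_x (E a b (c + s) x * S x ^+ k)%:E)%E.
Proof.
have mES a' b' c' : measurable_fun setT (fun x => (E a' b' c' x * S x ^+ k)%:E).
  by apply/measurable_EFinP/measurable_funM => //; exact: measurable_funX.
have ES0 a' b' c' x : (0 <= (E a' b' c' x * S x ^+ k)%:E)%E.
  by rewrite lee_fin mulr_ge0 ?expR_ge0// exprn_ge0.
transitivity (\int[m]_x (w1%:E * (E (a + s) b c x * S x ^+ k)%:E +
   w2%:E * (E a (b + s) c x * S x ^+ k)%:E +
   w3%:E * (E a b (c + s) x * S x ^+ k)%:E))%E.
  apply: eq_integral => x _; rewrite -!EFinM -!EFinD; congr (_%:E).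
  rewrite exprS mulrA [E a b c x * S x](_ : _ = w1 * E (a + s) b c x +
    w2 * E a (b + s) c x + w3 * E a b (c + s) x); first by ring.
  have -> : E (a + s) b c x = E a b c x * expR (- (s * x.1.1)).
    by rewrite /E -expRD; congr expR; ring.
  have -> : E a (b + s) c x = E a b c x * expR (- (s * x.1.2)).
    by rewrite /E -expRD; congr expR; ring.
  have -> : E a b (c + s) x = E a b c x * expR (- (s * x.2)).
    by rewrite /E -expRD; congr expR; ring.
  by rewrite /S; ring.
have mZ (r : R) a' b' c' :
    measurable_fun setT (fun x => (r%:E * (E a' b' c' x * S x ^+ k)%:E)%E).
  by apply: emeasurable_funM => //; exact: measurable_cst.
have Z0 (r : R) a' b' c' x :
  0 <= r -> (0 <= r%:E * (E a' b' c' x * S x ^+ k)%:E)%E.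
  by move=> r0; rewrite mule_ge0.
have ZD0 x : (0 <= w1%:E * (E (a + s) b c x * S x ^+ k)%:E +
    w2%:E * (E a (b + s) c x * S x ^+ k)%:E)%E.
  by apply: adde_ge0; exact: Z0.
rewrite ge0_integralD//; [|exact: emeasurable_funD|by move=> x _; exact: Z0].
rewrite ge0_integralD//; [|by move=> x _; exact: Z0..].
by rewrite !ge0_integralZl.
Qed.

Let W := w1 + w2 + w3.

Let ES12 k : forall a b c, 0 <= a -> 0 <= b -> 0 <= c ->
  (\int[m1]_x (E a b c x * S x ^+ k)%:E = \int[m2]_x (E a b c x *
    S x ^+ k)%:E)%E /\
  (\int[m1]_x (E a b c x * S x ^+ k)%:E <= (W ^+ k)%:E)%E.
Proof.
elim: k => [a b c a0 b0 c0|k IH a b c a0 b0 c0].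
  under eq_integral do rewrite expr0 mulr1.
  under [X in _ = X /\ _]eq_integral do rewrite expr0 mulr1.
  rewrite expr0; split; first exact: (L12 a0 b0 c0).
  exact: (L1 a0 b0 c0).
have [e1 i1] := IH _ _ _ (addr_ge0 a0 s0) b0 c0.
have [e2 i2] := IH _ _ _ a0 (addr_ge0 b0 s0) c0.
have [e3 i3] := IH _ _ _ a0 b0 (addr_ge0 c0 s0).
rewrite !ES; split; first by rewrite e1 e2 e3.
rewrite exprS /W -/W !mulrDl !EFinD !EFinM.
have le_wE (w : R) (I : \bar R) (r : R) :
    0 <= w -> (I <= r%:E -> w%:E * I <= w%:E * r%:E)%E.
  by move=> w0' hI; apply: lee_wpmul2l.
exact: (leeD (leeD (le_wE _ _ _ w10 i1) (le_wE _ _ _ w20 i2)) (le_wE _ _ _ w30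
  i3)).
Qed.

(** The moments of [S] agree under both laws and are at most [W ^+ n], so the exponential series
    converges and [laplace_same_moments] applies with weight 1 and [h = -1]. *)
Lemma integral_expRN_eq :
  (\int[m1]_x (expR (- S x))%:E = \int[m2]_x (expR (- S x))%:E)%E.
Proof.
have S12 k : (\int[m1]_x (S x ^+ k)%:E = \int[m2]_x (S x ^+ k)%:E)%E /\
    (\int[m1]_x (S x ^+ k)%:E <= (W ^+ k)%:E)%E.
  have := @ES12 k 0 0 0 (lexx _) (lexx _) (lexx _).
  have E0 x : E 0 0 0 x * S x ^+ k = S x ^+ k.
    by rewrite /E !mul0r !addr0 oppr0 expR0 mul1r.
  by under eq_integral do rewrite E0;
    under [X in _ = X /\ _]eq_integral do rewrite E0.
have iS (m : probability (mR3 R) R) n :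
    (\int[m]_x (S x ^+ n)%:E <= (W ^+ n)%:E)%E ->
    m.-integrable setT (fun x => (S x ^+ n * 1)%:E).
  move=> h; apply/integrableP; split.
    by apply/measurable_EFinP/measurable_funM => //; exact: measurable_funX.
  apply: (@le_lt_trans _ _ (W ^+ n)%:E); last by rewrite ltry.
  apply: le_trans h; rewrite le_eqVlt; apply/orP; left; apply/eqP.
  by apply: eq_integral => x _; rewrite mulr1 gee0_abs// lee_fin exprn_ge0.
have e1 (m : probability (mR3 R) R) : (\int[m]_x (expR (- S x))%:E =
    \int[m]_x (cst 1 x * expR (-1 * S x))%:E)%E.
  by apply: eq_integral => x _; rewrite mul1r mulN1r.
rewrite !e1.
apply: (@laplace_same_moments _ (mR3 R) _ (mR3 R) R m1 m2 S (cst 1) S (cst 1))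
  => //.
- by move=> n; apply: iS; exact: (S12 n).2.
- by move=> n; apply: iS; rewrite -(S12 n).1; exact: (S12 n).2.
- move=> n; rewrite /Rintegral.
  under eq_integral do rewrite mulr1.
  under [X in _ = fine X]eq_integral do rewrite mulr1.
  by rewrite (S12 n).1.
rewrite integral_cosh_moments//; last first.
  by move=> n; apply: iS; rewrite -(S12 n).1; exact: (S12 n).2.
apply: (@le_lt_trans _ _ (expR W + expR (- W))%:E); last by rewrite ltry.
have M0 n : 0 <= (\int[m2]_x (S x ^+ n * cst 1 x))%R.
  by apply: Rintegral_ge0 => x _; rewrite mulr1 exprn_ge0.
have MW n : (\int[m2]_x (S x ^+ n * cst 1 x))%R <= W ^+ n.
  rewrite -lee_fin /Rintegral fineK.
    under eq_integral do rewrite mulr1.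
    by rewrite -(S12 n).1 (S12 n).2.
  apply: integrable_fin_num => //.
  by apply: iS; rewrite -(S12 n).1; exact: (S12 n).2.
have N0 n : 0 <= ((-1) ^+ n + (- -1) ^+ n) / n`!%:R :> R.
  by rewrite divr_ge0// exprDN_ge0.
rewrite -expRDN_nneseries; apply: lee_nneseries.
  by move=> n _; rewrite lee_fin mulr_ge0.
move=> n _; rewrite lee_fin; apply: le_trans (ler_wpM2l (N0 n) (MW n)) _.
by rewrite opprK expr1n mulrAC mulrDl mul1r -exprMn mulN1r addrC.
Qed.

End exponential_polynomial.

Let T (n : nat) (c : R * R * R) (x : mR3 R) : R :=
  n%:R * expR (n%:R * c.1.1) * expR (- (n%:R * x.1.1)) +
  n%:R * expR (n%:R * c.1.2) * expR (- (n%:R * x.1.2)) +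
  n%:R * expR (n%:R * c.2) * expR (- (n%:R * x.2)).

(** The integrand is a product of three double exponentials, one per coordinate, and tends to the
    indicator of the box under the constant bound 1. *)
Let cvg_box (m : probability (mR3 R) R) c :
  (\int[m]_x (expR (- T n c x))%:E)%E @[n --> \oo] --> m (box3 c).
Proof.
have mterm n (k : R) (X : mR3 R -> R) : measurable_fun setT X ->
    measurable_fun setT (fun x =>
      n%:R * expR (n%:R * k) * expR (- (n%:R * X x))).
  move=> mX; apply: measurable_funM => //; apply: measurableT_comp => //.
  by apply: measurable_funN; exact: measurable_funM.
have mT n : measurable_fun setT (fun x => expR (- T n c x)).
  apply: measurableT_comp => //; apply: measurable_funN.
  by apply: measurable_funD; [apply: measurable_funD|]; apply: mterm;
    [exact: measurable_coord1|exact: measurable_coord2|exact: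
      measurable_coord3].
have T0 n x : 0 <= T n c x by rewrite !addr_ge0// !mulr_ge0 ?expR_ge0.
have -> : m (box3 c) = (\int[m]_x (\1_(box3 c) x)%:E)%E.
  by rewrite integral_indic ?setIT//; exact: measurable_box3.
apply: (@dominated_cvg _ _ _ m setT measurableT
  (fun n x => (expR (- T n c x))%:E) (fun x =>
    (\1_(box3 c) x)%:E) (cst 1%E)) => //.
- by move=> n; exact/measurable_EFinP.
- move=> x _; apply: cvg_EFin; first exact: nearW.
  suff : expR (- T n c x) @[n --> \oo] --> (\1_(box3 c) x : R) by [].
  have TE n : expR (- T n c x) = expR (- (n%:R * expR (n%:R *
    (c.1.1 - x.1.1)))) *
     expR (- (n%:R * expR (n%:R * (c.1.2 - x.1.2)))) *
     expR (- (n%:R * expR (n%:R * (c.2 - x.2)))).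
    rewrite -!expRD; congr expR; rewrite /T !mulrBr !expRD; ring.
  under eq_fun do rewrite TE.
  have -> : \1_(box3 c) x = (c.1.1 - x.1.1 < 0)%R%:R *
    (c.1.2 - x.1.2 < 0)%R%:R *
      (c.2 - x.2 < 0)%R%:R :> R.
    rewrite -!natrM !mulnb indicE !subr_lt0; congr (nat_of_bool _)%:R.
    apply/idP/idP; rewrite inE /box3/=; first by move=> [-> -> ->].
    by move=> /andP[/andP[-> ->] ->].
  by apply: cvgM; [apply: cvgM|]; exact: cvg_double_exp.
- exact: (finite_measure_integrable_cst m 1).
- move=> n x _; rewrite lee_fin ger0_norm ?expR_ge0//.
  by rewrite expR_le1 oppr_le0.
Qed.

Lemma laplace3_unique A : measurable A -> m1 A = m2 A.
Proof.
apply: measure_unique_boxes3 => c.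
  by apply: (le_lt_trans (probability_le1 _ _));
    [exact: measurable_box3|rewrite ltry].
have h n : (\int[m1]_x (expR (- T n c x))%:E = \int[m2]_x (expR (- T n c
  x))%:E)%E.
  by apply: integral_expRN_eq; rewrite ?mulr_ge0 ?expR_ge0.
have c1 := @cvg_box m1 c; have c2 := @cvg_box m2 c.
have e : (fun n => \int[m1]_x (expR (- T n c x))%:E)%E =
    (fun n => \int[m2]_x (expR (- T n c x))%:E)%E by apply/funext.
by rewrite e in c1; exact: (cvg_unique (@ereal_hausdorff R) c1 c2).
Qed.

End laplace_unique.

(** * Negative binomial series and the series F_II *)

Section negative_binomial.
Context {R : realType}.
Notation mu := (@lebesgue_measure R).

Lemma mul_expR_nneseries (c y : R) :
  ((c * expR y)%:E = \sum_(n <oo) (c * (y ^+ n / n`!%:R))%:E)%E.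
Proof.
apply/esym/cvg_lim => //.
have -> : (fun n => \sum_(0 <= k < n) (c * (y ^+ k / k`!%:R))%:E)%E =
   EFin \o (fun n => c * series (fun n => y ^+ n / n`!%:R) n).
  by apply/funext => n; rewrite /= sumEFin /series/= mulr_sumr.
apply: cvg_EFin; first exact: nearW.
by apply: cvgM; [exact: cvg_cst|exact: cvg_series_expR].
Qed.

Lemma pochhammer_gt0 (a : R) n : 0 < a -> 0 < pochhammer a n.
Proof.
by move=> a0; elim: n => [|n IH] /=; rewrite ?ltr01// mulr_gt0// ltr_wpDr.
Qed.

Lemma pochhammerD (a : R) m n :
  pochhammer a (m + n) = pochhammer a m * pochhammer (a + m%:R) n.
Proof.
elim: n => [|n IH]; first by rewrite addn0 mulr1.
by rewrite addnS /= IH natrD; ring.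
Qed.

(** In the gamma integral of rate [w - y], expand exp (y x) and integrate term by term at rate
    [w]. *)
Lemma negative_binomial_series (b y w : R) : 0 < b -> 0 <= y -> y < w ->
  (\sum_(n <oo) (pochhammer b n / n`!%:R * y ^+ n * w `^ (- (b + n%:R)))%:E =
   ((w - y) `^ (- b))%:E)%E.
Proof.
move=> b0 y0 yw; have w0 : 0 < w by exact: le_lt_trans yw.
have G0 := Gamma_fun_gt0 b0.
have bn0 n : 0 < b + n%:R by rewrite ltr_wpDr.
have -> : ((w - y) `^ (- b))%:E = ((Gamma_fun b)^-1%:E *
    \int[mu]_x (gamma_weight b x * expR (- ((w - y) * x)))%:E)%E.
  by rewrite gamma_weight_integral// ?subr_gt0// -EFinM mulKf// gt_eqF.
transitivity ((Gamma_fun b)^-1%:E * \sum_(n <oo)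
    \int[mu]_x ((y ^+ n / n`!%:R) * (gamma_weight (b +
      n%:R) x * expR (- (w * x))))%:E)%E.
  have E n : (\int[mu]_x ((y ^+ n / n`!%:R) *
      (gamma_weight (b + n%:R) x * expR (- (w * x))))%:E =
      (Gamma_fun b * (pochhammer b n / n`!%:R * y ^+ n * w `^ (- (b +
        n%:R))))%:E)%E.
    under eq_integral do rewrite EFinM.
    rewrite ge0_integralZl//; last 3 first.
    - apply/measurable_EFinP; apply: measurable_weighted_exp => //.
      exact: measurable_gamma_weight.
    - by move=> x _; rewrite lee_fin mulr_ge0 ?expR_ge0// gamma_weight_ge0.
    - by rewrite lee_fin divr_ge0// exprn_ge0.
    rewrite gamma_weight_integral// -EFinM Gamma_funD//; congr (_%:E); ring.
  under [in RHS]eq_eseriesr do rewrite E.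
  rewrite -nneseriesZl//.
    by apply: eq_eseriesr => n _; rewrite -EFinM mulKf// gt_eqF.
  move=> n _; rewrite lee_fin !mulr_ge0 ?powR_ge0 ?exprn_ge0 ?(ltW G0)//.
  by rewrite ltW// pochhammer_gt0.
congr (_ * _)%E; rewrite -integral_nneseries//; last 2 first.
- move=> n; apply/measurable_EFinP; apply: measurable_funM => //.
  by apply: measurable_weighted_exp => //; exact: measurable_gamma_weight.
- move=> n x _; rewrite lee_fin mulr_ge0 ?divr_ge0 ?exprn_ge0//.
  by rewrite mulr_ge0 ?expR_ge0// gamma_weight_ge0.
apply: eq_integral => x _.
have -> : - ((w - y) * x) = - (w * x) + y * x by ring.
rewrite expRD mulrA mul_expR_nneseries; apply: eq_eseriesr => n _.
by rewrite -gamma_weightX exprMn; congr (_%:E); ring.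
Qed.

(** The innermost sum is removed three times with [negative_binomial_series]; [pochhammerD] splits
    the symbol so that the next parameter is [b] plus the remaining indices. *)
Lemma triple_negative_binomial (b y1 y2 y3 w : R) : 0 < b ->
  0 <= y1 -> 0 <= y2 -> 0 <= y3 -> y1 + y2 + y3 < w ->
  (\sum_(m1 <oo) \sum_(m2 <oo) \sum_(m3 <oo)
    (pochhammer b (m1 + m2 + m3) / (m1`!%:R * m2`!%:R * m3`!%:R) *
     (y1 ^+ m1 * y2 ^+ m2 * y3 ^+ m3) * w `^ (- (b + (m1 + m2 + m3)%:R)))%:E =
   ((w - y1 - y2 - y3) `^ (- b))%:E)%E.
Proof.
move=> b0 y10 y20 y30 yw.
have bn0 n : 0 < b + n%:R by rewrite ltr_wpDr.
have p0 (a : R) n : 0 < a -> 0 <= pochhammer a n by move=> a0;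
  rewrite ltW// pochhammer_gt0.
transitivity (\sum_(m1 <oo) \sum_(m2 <oo)
    ((pochhammer b (m1 + m2) / (m1`!%:R * m2`!%:R) * (y1 ^+ m1 * y2 ^+ m2)) *
     (w - y3) `^ (- (b + (m1 + m2)%:R)))%:E)%E.
  apply: eq_eseriesr => m1 _; apply: eq_eseriesr => m2 _.
  rewrite EFinM -negative_binomial_series//; last by lra.
  rewrite -nneseriesZl; last first.
    by move=> n _; rewrite lee_fin !mulr_ge0 ?invr_ge0 ?powR_ge0 ?exprn_ge0//
      p0.
  apply: eq_eseriesr => m3 _; rewrite -EFinM; congr (_%:E).
  rewrite pochhammerD !natrD !addrA !invfM; ring.
transitivity (\sum_(m1 <oo)
    ((pochhammer b m1 / m1`!%:R * y1 ^+ m1) *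
     (w - y3 - y2) `^ (- (b + m1%:R)))%:E)%E.
  apply: eq_eseriesr => m1 _.
  rewrite EFinM -negative_binomial_series//; last by lra.
  rewrite -nneseriesZl; last first.
    by move=> n _; rewrite lee_fin !mulr_ge0 ?invr_ge0 ?powR_ge0 ?exprn_ge0//
      p0.
  apply: eq_eseriesr => m2 _; rewrite -EFinM; congr (_%:E).
  rewrite pochhammerD !natrD !addrA !invfM; ring.
rewrite negative_binomial_series//; last by lra.
by congr ((_ `^ _)%:E); ring.
Qed.

End negative_binomial.

(** * Summing [F_II] as an iterated series *)

Section diagonal.
Context {R : realType}.
Local Open Scope ereal_scope.

(** Here the range and the terms grow together. The upper bound is termwise; for the lower bound,
    freeze the range at [K], let the terms converge, and only then let [K] grow. *)
Lemma nneseries_diagonal (f : nat -> nat -> \bar R) (l : nat -> \bar R) :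
  (forall N m, 0 <= f N m) -> (forall m, nondecreasing_seq (f ^~ m)) ->
  (forall m, f N m @[N --> \oo] --> l m) ->
  \sum_(m < N) f N m @[N --> \oo] --> \sum_(m <oo) l m.
Proof.
move=> f0 fnd fl.
have fle N m : f N m <= l m.
  have := ereal_nondecreasing_cvgn (fnd m) => h.
  rewrite -(cvg_unique (@ereal_hausdorff R) h (fl m)).
  by apply: ereal_sup_ubound; exists N.
have l0 m : 0 <= l m by apply: le_trans (fle 0%N m).
pose S N := \sum_(m < N) f N m.
have Snd : nondecreasing_seq S.
  move=> N N' NN'; rewrite /S.
  apply: (@le_trans _ _ (\sum_(m < N) f N' m)).
    by apply: lee_sum => m _; exact: fnd.
  rewrite -!(big_mkord xpredT (fun m => f N' m)).
  exact: lee_sum_nneg_natr.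
have cS := ereal_nondecreasing_is_cvgn Snd.
suff : limn S = \sum_(m <oo) l m by move=> <-.
apply/eqP; rewrite eq_le; apply/andP; split.
  apply: lime_le => //; apply: nearW => N.
  apply: (@le_trans _ _ (\sum_(m < N) l m)); first exact: lee_sum.
  by rewrite -(big_mkord xpredT l); exact: nneseries_lim_ge.
apply: lime_le; first exact: is_cvg_nneseries.
apply: nearW => K; rewrite big_mkord.
have cK : \sum_(m < K) f N m @[N --> \oo] --> \sum_(m < K) l m.
  by apply: cvg_nnesum => // j _; exact: nearW.
rewrite -(cvg_lim _ cK)//; apply: lee_lim => //.
  by apply/cvg_ex; eexists; exact: cK.
near=> N; rewrite /S -!(big_mkord xpredT (fun m => f N m)).
by apply: lee_sum_nneg_natr => //; near: N; exists K.
Unshelve. all: by end_near. Qed.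

End diagonal.

Section F_II_series.
Context {R : realType}.

Lemma nondecreasing_diagonal (f : nat -> nat -> \bar R) :
  (forall N m, 0 <= f N m)%E -> (forall m, nondecreasing_seq (f ^~ m)) ->
  nondecreasing_seq (fun N => \sum_(m < N) f N m)%E.
Proof.
move=> f0 fnd N N' NN'.
apply: (@le_trans _ _ (\sum_(m < N) f N' m)%E).
  by apply: lee_sum => m _; exact: fnd.
rewrite -!(big_mkord xpredT (fun m => f N' m)).
exact: lee_sum_nneg_natr.
Qed.

Lemma cube_cvg_nneseries (a : nat -> nat -> nat -> nat -> \bar R) :
  (forall m1 m2 m3 m4, 0 <= a m1 m2 m3 m4)%E ->
  (\sum_(m1 < N) \sum_(m2 < N) \sum_(m3 < N) \sum_(m4 < N) a m1 m2 m3 m4)%E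
    @[N --> \oo] -->
  (\sum_(m1 <oo) \sum_(m2 <oo) \sum_(m3 <oo) \sum_(m4 <oo) a m1 m2 m3 m4)%E.
Proof.
move=> a0.
have n4 m1 m2 m3 : nondecreasing_seq (fun N => \sum_(m4 < N) a m1 m2 m3 m4)%E.
  by apply: (@nondecreasing_diagonal (fun N m4 => a m1 m2 m3 m4)) =>
    // m4 N N' _.
have p4 m1 m2 m3 (N : nat) :
  (0 <= \sum_(m4 < N) a m1 m2 m3 m4)%E by exact: sume_ge0.
have n3 m1 m2 : nondecreasing_seq
    (fun N => \sum_(m3 < N) \sum_(m4 < N) a m1 m2 m3 m4)%E.
  apply: (@nondecreasing_diagonal (fun N m3 =>
    \sum_(m4 < N) a m1 m2 m3 m4)%E) => [N m3|m3]; [exact: p4|exact: n4].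
have p3 m1 m2 (N : nat) : (0 <= \sum_(m3 < N) \sum_(m4 < N) a m1 m2 m3 m4)%E.
  by apply: sume_ge0 => m3 _; exact: p4.
have n2 m1 : nondecreasing_seq
    (fun N => \sum_(m2 < N) \sum_(m3 < N) \sum_(m4 < N) a m1 m2 m3 m4)%E.
  apply: (@nondecreasing_diagonal (fun N m2 =>
    \sum_(m3 < N) \sum_(m4 < N) a m1 m2 m3 m4)%E) => [N m2|m2];
      [exact: p3|exact: n3].
have p2 m1 (N : nat) :
    (0 <= \sum_(m2 < N) \sum_(m3 < N) \sum_(m4 < N) a m1 m2 m3 m4)%E.
  by apply: sume_ge0 => m2 _; exact: p3.
apply: (@nneseries_diagonal _
  (fun N m1 => \sum_(m2 < N) \sum_(m3 < N) \sum_(m4 < N) a m1 m2 m3 m4)%E) =>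
    // m1.
apply: (@nneseries_diagonal _
  (fun N m2 => \sum_(m3 < N) \sum_(m4 < N) a m1 m2 m3 m4)%E) => // m2.
apply: (@nneseries_diagonal _ (fun N m3 => \sum_(m4 < N) a m1 m2 m3 m4)%E) =>
  // m3.
by apply: (@nneseries_diagonal _ (fun N m4 => a m1 m2 m3 m4)) =>
  [//|m4 N N' _ //|m4]; exact: cvg_cst.
Qed.

Lemma pochhammer_ge (a : R) n : 0 < a -> Num.min 1 a <= pochhammer a n.
Proof.
move=> a0; elim: n => [|[|n] IH] /=; first by rewrite ge_min lexx.
  by rewrite addr0 mulr1 ge_min lexx orbT.
apply: le_trans IH _; rewrite -[leLHS]mul1r ler_wpM2r//.
  exact/ltW/(@pochhammer_gt0 _ _ n.+1).
by rewrite -natr1 addrA lerDr addr_ge0// ltW.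
Qed.

Lemma F_II_term_ge0 (l1 l2 z1 z2 z3 z4 : R) m1 m2 m3 m4 :
  0 < l1 -> 0 < l2 -> 0 <= z1 -> 0 <= z2 -> 0 <= z3 -> 0 <= z4 ->
  0 <= F_II_term l1 l2 z1 z2 z3 z4 m1 m2 m3 m4.
Proof.
move=> l10 l20 z10 z20 z30 z40; rewrite /F_II_term.
rewrite !mulr_ge0 ?invr_ge0 ?exprn_ge0 ?mulr_ge0// ?ler0n//;
  by rewrite ltW// pochhammer_gt0.
Qed.

(** The Pochhammer symbols are bounded below by [pochhammer_ge], so four exponential series dominate
    the sum. Its finiteness ensures that the real limit in [F_II] is a true limit and not a default
    value. *)
Lemma F_II_nneseries (l1 l2 z1 z2 z3 z4 : R) : 0 < l1 -> 0 < l2 ->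
  0 <= z1 -> 0 <= z2 -> 0 <= z3 -> 0 <= z4 ->
  ((F_II l1 l2 z1 z2 z3 z4)%:E =
   \sum_(m1 <oo) \sum_(m2 <oo) \sum_(m3 <oo) \sum_(m4 <oo)
     (F_II_term l1 l2 z1 z2 z3 z4 m1 m2 m3 m4)%:E)%E.
Proof.
move=> l10 l20 z10 z20 z30 z40.
set t := F_II_term l1 l2 z1 z2 z3 z4.
have t0 m1 m2 m3 m4 : (0 <= (t m1 m2 m3 m4)%:E)%E by rewrite lee_fin
  F_II_term_ge0.
have := @cube_cvg_nneseries (fun m1 m2 m3 m4 => (t m1 m2 m3 m4)%:E) t0.
set S := (X in _ --> X) => cS.
pose C : R := (Num.min 1 l1 * Num.min 1 l2)^-1.
have k1 : 0 < Num.min 1 l1 by rewrite lt_min ltr01.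
have k2 : 0 < Num.min 1 l2 by rewrite lt_min ltr01.
have C0 : 0 <= C by rewrite invr_ge0 mulr_ge0 ?ltW.
have e0 (z : R) m : 0 <= z -> 0 <= z ^+ m / m`!%:R.
  by move=> z0; rewrite divr_ge0// exprn_ge0.
have tle m1 m2 m3 m4 : t m1 m2 m3 m4 <= C * (z1 ^+ m1 / m1`!%:R) *
    (z2 ^+ m2 / m2`!%:R) * (z3 ^+ m3 / m3`!%:R) * (z4 ^+ m4 / m4`!%:R).
  rewrite /t /F_II_term; apply: (ler_wpM2r (e0 _ _ z40)).
  apply: (ler_wpM2r (e0 _ _ z30)); apply: (ler_wpM2r (e0 _ _ z20)).
  apply: (ler_wpM2r (e0 _ _ z10)).
  rewrite lef_pV2 ?posrE ?mulr_gt0 ?pochhammer_gt0//.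
  by rewrite ler_pM ?pochhammer_ge// ltW.
have Sfin : (S < +oo)%E.
  apply: (@le_lt_trans _ _ (C * expR z1 * expR z2 * expR z3 * expR z4)%:E);
    last by rewrite ltry.
  have x0 (z : R) : 0 <= expR z by exact: expR_ge0.
  have -> : C * expR z1 * expR z2 * expR z3 * expR z4 =
    C * expR z2 * expR z3 * expR z4 * expR z1 by ring.
  rewrite mul_expR_nneseries; apply: lee_nneseries => m1 _.
    by move=> _; do 3![apply: nneseries_ge0 => ? _ _].
  have -> : C * expR z2 * expR z3 * expR z4 * (z1 ^+ m1 / m1`!%:R) =
    C * (z1 ^+ m1 / m1`!%:R) * expR z3 * expR z4 * expR z2 by ring.
  rewrite mul_expR_nneseries; apply: lee_nneseries => m2 _.
    by move=> _; do 2![apply: nneseries_ge0 => ? _ _].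
  have -> : C * (z1 ^+ m1 / m1`!%:R) * expR z3 * expR z4 *
    (z2 ^+ m2 / m2`!%:R) =
    C * (z1 ^+ m1 / m1`!%:R) * (z2 ^+ m2 / m2`!%:R) * expR z4 * expR z3 by ring.
  rewrite mul_expR_nneseries; apply: lee_nneseries => m3 _.
    by move=> _; apply: nneseries_ge0 => ? _ _.
  have -> : C * (z1 ^+ m1 / m1`!%:R) * (z2 ^+ m2 / m2`!%:R) * expR z4 *
    (z3 ^+ m3 / m3`!%:R) = C * (z1 ^+ m1 / m1`!%:R) * (z2 ^+ m2 / m2`!%:R) *
    (z3 ^+ m3 / m3`!%:R) * expR z4 by ring.
  rewrite mul_expR_nneseries; apply: lee_nneseries => m4 _ //.
  by rewrite lee_fin.
have S0 : (0 <= S)%E by do 4![apply: nneseries_ge0 => ? _ _].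
have SE : S = (fine S)%:E by rewrite fineK// ge0_fin_numE.
suff -> : F_II l1 l2 z1 z2 z3 z4 = fine S by [].
apply/cvg_lim => //; move: cS; rewrite SE => /fine_cvg.
suff -> : (fun N : nat => \sum_(m1 < N) \sum_(m2 < N) \sum_(m3 < N) \sum_(m4 <
  N)
    (t m1 m2 m3 m4)%:E)%E = EFin \o (fun N : nat =>
    \sum_(m1 < N) \sum_(m2 < N) \sum_(m3 < N) \sum_(m4 < N) t m1 m2 m3 m4) by
      [].
by apply/funext => N /=; do 4 (rewrite -sumEFin; apply: eq_bigr => ? _).
Qed.

End F_II_series.

(** * The Laplace transform of the density *)

Section four_series.
Context {R : realType}.
Local Open Scope ereal_scope.

Definition series4 (a : nat -> nat -> nat -> nat -> \bar R) : \bar R :=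
  \sum_(m1 <oo) \sum_(m2 <oo) \sum_(m3 <oo) \sum_(m4 <oo) a m1 m2 m3 m4.

Lemma eq_series4 a b : (forall m1 m2 m3 m4, a m1 m2 m3 m4 = b m1 m2 m3 m4) ->
  series4 a = series4 b.
Proof.
move=> ab; apply: eq_eseriesr => m1 _; apply: eq_eseriesr => m2 _.
by apply: eq_eseriesr => m3 _; apply: eq_eseriesr => m4 _.
Qed.

Lemma series4_ge0 a : (forall m1 m2 m3 m4,
  0 <= a m1 m2 m3 m4) -> 0 <= series4 a.
Proof. by move=> a0; do 4![apply: nneseries_ge0 => ? _ _]. Qed.

Lemma series4Zl (c : R) a : (forall m1 m2 m3 m4, 0 <= a m1 m2 m3 m4) ->
  series4 (fun m1 m2 m3 m4 => c%:E * a m1 m2 m3 m4) = c%:E * series4 a.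
Proof.
move=> a0; rewrite /series4 -nneseriesZl; last first.
  by move=> m1 _; do 3![apply: nneseries_ge0 => ? _ _].
apply: eq_eseriesr => m1 _; rewrite -nneseriesZl; last first.
  by move=> m2 _; do 2![apply: nneseries_ge0 => ? _ _].
apply: eq_eseriesr => m2 _; rewrite -nneseriesZl; last first.
  by move=> m3 _; apply: nneseries_ge0 => ? _ _.
by apply: eq_eseriesr => m3 _; rewrite -nneseriesZl.
Qed.

Context d (T : measurableType d) (m : {measure set T -> \bar R}).
Variable f : nat -> nat -> nat -> nat -> T -> \bar R.
Hypothesis mf : forall m1 m2 m3 m4, measurable_fun setT (f m1 m2 m3 m4).
Hypothesis f0 : forall m1 m2 m3 m4 x, 0 <= f m1 m2 m3 m4 x.

Let ge0_msum (g : nat -> T -> \bar R) : (forall n, measurable_fun setT (g n)) ->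
  (forall n x, 0 <= g n x) -> measurable_fun setT (fun x => \sum_(n <oo) g n x).
Proof. by move=> mg g0; apply: ge0_emeasurable_sum. Qed.

Lemma measurable_series4 :
  measurable_fun setT (fun x => series4 (fun m1 m2 m3 m4 => f m1 m2 m3 m4 x)).
Proof.
apply: ge0_msum => [m1|m1 x]; last by do 3![apply: nneseries_ge0 => ? _ _].
apply: ge0_msum => [m2|m2 x]; last by do 2![apply: nneseries_ge0 => ? _ _].
apply: ge0_msum => [m3|m3 x]; last by apply: nneseries_ge0 => ? _ _.
exact: ge0_msum.
Qed.

Lemma integral_series4 :
  \int[m]_x series4 (fun m1 m2 m3 m4 => f m1 m2 m3 m4 x) =
  series4 (fun m1 m2 m3 m4 => \int[m]_x f m1 m2 m3 m4 x).
Proof.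
rewrite /series4 integral_nneseries//; last 2 first.
- move=> m1; apply: ge0_msum => [m2|m2 x];
  last by do 2![apply: nneseries_ge0 => ? _ _].
  apply: ge0_msum => [m3|m3 x]; last by apply: nneseries_ge0 => ? _ _.
  exact: ge0_msum.
- by move=> m1 x _; do 3![apply: nneseries_ge0 => ? _ _].
apply: eq_eseriesr => m1 _; rewrite integral_nneseries//; last 2 first.
- move=> m2; apply: ge0_msum => [m3|m3 x];
  last by apply: nneseries_ge0 => ? _ _.
  exact: ge0_msum.
- by move=> m2 x _; do 2![apply: nneseries_ge0 => ? _ _].
apply: eq_eseriesr => m2 _; rewrite integral_nneseries//; last 2 first.
- by move=> m3; apply: ge0_msum.
- by move=> m3 x _; apply: nneseries_ge0 => ? _ _.
by apply: eq_eseriesr => m3 _; rewrite integral_nneseries.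
Qed.

End four_series.

Lemma integral_prod_mul d1 d2 (T1 : measurableType d1) (T2 : measurableType d2)
    (R : realType) (m1 : {sigma_finite_measure set T1 -> \bar R})
    (m2 : {sigma_finite_measure set T2 -> \bar R}) (f : T1 -> R) (g :
      T2 -> R) (r : R) :
  measurable_fun setT f -> measurable_fun setT g ->
  (forall x, 0 <= f x) -> (forall x, 0 <= g x) ->
  (\int[m2]_y (g y)%:E = r%:E)%E ->
  (\int[m1 \x m2]_z (f z.1 * g z.2)%:E = \int[m1]_x (f x)%:E * r%:E)%E.
Proof.
move=> mf mg f0 g0 gr.
rewrite fubini_tonelli1//=; first last.
- by move=> x; rewrite lee_fin mulr_ge0.
- apply/measurable_EFinP; apply: measurable_funM.
    exact: measurableT_comp mf measurable_fst.
  exact: measurableT_comp mg measurable_snd.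
rewrite /fubini_F /=.
under eq_integral => x _.
  under eq_integral do rewrite EFinM.
  rewrite ge0_integralZl//; last 3 first.
  - exact/measurable_EFinP.
  - by move=> y _; rewrite lee_fin.
  - by rewrite lee_fin.
  rewrite gr; over.
rewrite ge0_integralZr//.
- exact/measurable_EFinP.
- by move=> y _; rewrite lee_fin.
- by rewrite -gr integral_ge0// => y _; rewrite lee_fin.
Qed.

(** * Integration in the variables x1 and x2 *)

Section plane_integral.
Context {R : realType}.
Notation mu := (@lebesgue_measure R).
Variables (a s1 s2 s3 c1 c2 : R).
Hypotheses (a0 : 0 < a) (s30 : 0 < s3) (c10 : 0 <= c1) (c20 : 0 <= c2).
Hypotheses (t10 : 0 < s1 - c1 / s3) (t20 : 0 < s2 - c2 / s3).

Definition plane_term (k : nat) (x : measurableTypeR R * measurableTypeR R) :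
  R :=
  gamma_weight a x.1 * gamma_weight a x.2 * ((c1 * x.1 +
    c2 * x.2) ^+ k / k`!%:R) *
  expR (- (s1 * x.1 + s2 * x.2)).

Lemma gamma_weight2_ge0 x1 x2 : 0 <= gamma_weight a x1 * gamma_weight a x2.
Proof. by rewrite mulr_ge0// gamma_weight_ge0. Qed.

Lemma gamma_weight_le0 (b x : R) : x <= 0 -> gamma_weight b x = 0.
Proof.
move=> x0; rewrite /gamma_weight indicE memNset ?mulr0//=.
by rewrite in_itv/= andbT; apply/negP; rewrite -leNgt.
Qed.

Lemma plane_term_ge0 k x : 0 <= plane_term k x.
Proof.
rewrite /plane_term; have [x10|x10] := leP x.1 0.
  by rewrite (gamma_weight_le0 _ x10) !mul0r.
have [x20|x20] := leP x.2 0.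
  by rewrite (gamma_weight_le0 _ x20) mulr0 !mul0r.
rewrite mulr_ge0 ?expR_ge0// mulr_ge0 ?gamma_weight2_ge0// divr_ge0//
  exprn_ge0//.
by rewrite addr_ge0// mulr_ge0// ltW.
Qed.

Lemma measurable_plane_term k : measurable_fun setT (plane_term k).
Proof.
have m1 : measurable_fun setT (fun x :
  measurableTypeR R * measurableTypeR R => x.1 : R).
  exact: measurable_fst.
have m2 : measurable_fun setT (fun x :
  measurableTypeR R * measurableTypeR R => x.2 : R).
  exact: measurable_snd.
apply: measurable_funM; last first.
  apply: measurableT_comp => //; apply: measurable_funN.
  by apply: measurable_funD; exact: measurable_funM.
apply: measurable_funM; last first.
  apply: measurable_funM => //; apply: measurable_funX.
  by apply: measurable_funD; exact: measurable_funM.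
by apply: measurable_funM;
  [exact: measurableT_comp (measurable_gamma_weight a) measurable_fst|
   exact: measurableT_comp (measurable_gamma_weight a) measurable_snd].
Qed.

(** The sum over [k] is exp ((c1 x1 + c2 x2) / s3), which lowers the rates [s1] and [s2]; what
    remains is a product of two gamma integrals. *)
Lemma plane_series :
  (\sum_(k <oo) (s3 ^- k)%:E * \int[mu \x mu]_x (plane_term k x)%:E =
   (Gamma_fun a ^+ 2 * ((s1 - c1 / s3) * (s2 - c2 / s3)) `^ (- a))%:E)%E.
Proof.
transitivity (\int[mu \x mu]_x \sum_(k <oo) ((s3 ^- k) * plane_term k x)%:E)%E.
  rewrite integral_nneseries//; last 2 first.
  - move=> k; apply/measurable_EFinP; apply: measurable_funM => //.
    exact: measurable_plane_term.
  - by move=> k x _; rewrite lee_fin mulr_ge0 ?plane_term_ge0// invr_ge0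
    exprn_ge0// ltW.
  apply: eq_eseriesr => k _; under [RHS]eq_integral do rewrite EFinM.
  rewrite ge0_integralZl//.
  - by apply/measurable_EFinP; exact: measurable_plane_term.
  - by move=> x _; rewrite lee_fin plane_term_ge0.
  - by rewrite lee_fin invr_ge0 exprn_ge0// ltW.
transitivity (\int[mu \x mu]_x
    (gamma_weight a x.1 * expR (- ((s1 - c1 / s3) * x.1)) *
     (gamma_weight a x.2 * expR (- ((s2 - c2 / s3) * x.2))))%:E)%E.
  apply: eq_integral => x _.
  transitivity (\sum_(k <oo) (gamma_weight a x.1 * gamma_weight a x.2 *
      expR (- (s1 * x.1 + s2 * x.2)) * (((c1 * x.1 +
        c2 * x.2) / s3) ^+ k / k`!%:R))%:E)%E.
    apply: eq_eseriesr => k _; congr (_%:E).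
    by rewrite /plane_term exprMn exprVn; ring.
  rewrite -mul_expR_nneseries -mulrA -expRD; congr (_%:E).
  transitivity (gamma_weight a x.1 * gamma_weight a x.2 *
    (expR (- ((s1 - c1 / s3) * x.1)) * expR (- ((s2 - c2 / s3) * x.2))));
      last by ring.
  by rewrite -expRD; congr (_ * expR _); ring.
rewrite (@integral_prod_mul _ _ _ _ _ mu mu
  (fun x => gamma_weight a x * expR (- ((s1 - c1 / s3) * x)))
  (fun x => gamma_weight a x * expR (- ((s2 - c2 / s3) * x)))
  (Gamma_fun a * (s2 - c2 / s3) `^ (- a))).
- rewrite gamma_weight_integral// -EFinM powRM ?(ltW t10) ?(ltW t20)//.
  by congr (_%:E); ring.
- by apply: measurable_weighted_exp => //; exact: measurable_gamma_weight.
- by apply: measurable_weighted_exp => //; exact: measurable_gamma_weight.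
- by move=> x; rewrite mulr_ge0 ?expR_ge0// gamma_weight_ge0.
- by move=> x; rewrite mulr_ge0 ?expR_ge0// gamma_weight_ge0.
- by rewrite gamma_weight_integral.
Qed.

End plane_integral.

Section lebesgue3_product.
Context {R : realType}.
Notation mu := (@lebesgue_measure R).

Lemma sigma_finite_lebesgue2 : sigma_finite setT (mu \x mu)%E.
Proof.
pose I n : set (measurableTypeR R) := `]- n%:R, n%:R[%classic.
exists (fun n => I n `*` I n).
  apply/seteqP; split=> // -[x y] _.
  have [n [hx hy _]] := exists_nat_gtN3 (- `|x|) (- `|y|) 0.
  exists n => //; rewrite /I /=; split; rewrite /= in_itv/= -ltr_norml; lra.
move=> n; have mI : measurable (I n) by exact: measurable_itv.
split; first exact: measurableX.
have fin : (mu (I n) < +oo)%E.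
  by rewrite /I lebesgue_measure_itv/=; case: ifP => _; rewrite -?EFinB ltry.
by rewrite product_measure1E// lte_mul_pinfty// ge0_fin_numE.
Qed.

(* Canonical inference on a product measure only finds the instance for
   products of subprobabilities, hence the explicit packing. *)
Definition lebesgue2 : {sigma_finite_measure set (measurableTypeR R *
  measurableTypeR R)%type -> \bar R} :=
  HB.pack (mu \x mu)%E (Measure_isSigmaFinite.Build _ _ _ (mu \x mu)%E
    sigma_finite_lebesgue2).

Lemma integral_lebesgue3_mul (f : measurableTypeR R * measurableTypeR R -> R)
    (g : measurableTypeR R -> R) (r : R) :
  measurable_fun setT f -> measurable_fun setT g ->
  (forall x, 0 <= f x) -> (forall x, 0 <= g x) ->
  (\int[mu]_y (g y)%:E = r%:E)%E ->
  (\int[lebesgue3]_z (f z.1 * g z.2)%:E = \int[mu \x mu]_x (f x)%:E * r%:E)%E.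
Proof. exact: (@integral_prod_mul _ _ _ _ R lebesgue2 mu). Qed.

End lebesgue3_product.

Section gamma_density.
Context {R : realType}.
Variables (lam p123 q1 q2 q3 b12 b13 b23 b123 : R).
Hypotheses (lam0 : 0 < lam) (p0 : 0 < p123).
Hypotheses (b12_ge0 : 0 <= b12) (b13_ge0 : 0 <= b13) (b23_ge0 : 0 <= b23).
Hypothesis b123_ge0 : 0 <= b123.

Definition gamma_density (x : R * R * R) : R :=
  let x1 := x.1.1 in let x2 := x.1.2 in let x3 := x.2 in
  p123 `^ (- lam) / Gamma_fun lam ^+ 3
    * expR (q1 * x1 + q2 * x2 + q3 * x3)
    * (x1 * x2 * x3) `^ (lam - 1)
    * F_II lam lam (b13 * b23 * (x1 * x2 * x3 ^+ 2)) (b123 * (x1 * x2 * x3))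
        (b12 * (x1 * x2)) (b13 * (x1 * x3) + b23 * (x2 * x3))
    * \1_[set y : R * R * R | [/\ 0 < y.1.1, 0 < y.1.2 & 0 < y.2]] x.

Let C0 := p123 `^ (- lam) / Gamma_fun lam ^+ 3.
Let G0 : 0 < Gamma_fun lam := Gamma_fun_gt0 lam0.

Let C0_ge0 : 0 <= C0.
Proof. by rewrite divr_ge0 ?powR_ge0// exprn_ge0// ltW. Qed.

Let coef m1 m2 m3 := C0 / pochhammer lam (m1 + m2 + m3) *
  ((b13 * b23) ^+ m1 / m1`!%:R) * (b123 ^+ m2 / m2`!%:R) *
    (b12 ^+ m3 / m3`!%:R).

Let poch0 n : 0 < pochhammer lam n. Proof. exact: pochhammer_gt0. Qed.

Let coef_ge0 m1 m2 m3 : 0 <= coef m1 m2 m3.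
Proof.
have e0 (z : R) m : 0 <= z -> 0 <= z ^+ m / m`!%:R.
  by move=> z0; rewrite divr_ge0// exprn_ge0.
rewrite /coef; apply: mulr_ge0; last exact: e0.
apply: mulr_ge0; last exact: e0.
apply: mulr_ge0; last by apply: e0; exact: mulr_ge0.
by rewrite divr_ge0// ltW.
Qed.

(** The powers of the variables are absorbed into gamma kernels: x1 and x2 each receive m1 + m2 +
    m3, apart from the power of b13 x1 + b23 x2, and x3 receives 2 m1 + m2 + m4, the index of the
    second Pochhammer symbol. *)
Definition density_term (s1 s2 s3 : R) m1 m2 m3 m4 (x : mR3 R) : R :=
  coef m1 m2 m3 / pochhammer lam (2 * m1 + m2 + m4) *
  (plane_term (lam + (m1 + m2 + m3)%:R) s1 s2 b13 b23 m4 x.1 *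
   (gamma_weight (lam + (2 * m1 + m2 + m4)%:R) x.2 * expR (- (s3 * x.2)))).

Lemma density_term_ge0 s1 s2 s3 m1 m2 m3 m4 x :
  0 <= density_term s1 s2 s3 m1 m2 m3 m4 x.
Proof.
apply: mulr_ge0; first by rewrite divr_ge0// ltW.
apply: mulr_ge0; first exact: plane_term_ge0.
by rewrite mulr_ge0 ?expR_ge0// gamma_weight_ge0.
Qed.

Lemma measurable_density_term s1 s2 s3 m1 m2 m3 m4 :
  measurable_fun setT (density_term s1 s2 s3 m1 m2 m3 m4).
Proof.
apply: measurable_funM => //; apply: measurable_funM.
  exact: measurableT_comp (measurable_plane_term _ _ _ _ _ _) measurable_fst.
apply: (measurableT_comp (f := fun x : measurableTypeR R =>
   gamma_weight (lam + (2 * m1 + m2 + m4)%:R) x * expR (- (s3 * x)))) => //.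
apply: measurable_weighted_exp => //; exact: measurable_gamma_weight.
Qed.

Lemma gamma_density_series (th : R * R * R) (x : mR3 R) :
  ((gamma_density x *
      expR (- (th.1.1 * x.1.1 + th.1.2 * x.1.2 + th.2 * x.2)))%:E =
   series4 (fun m1 m2 m3 m4 =>
     (density_term (th.1.1 - q1) (th.1.2 - q2) (th.2 - q3) m1 m2 m3 m4
       x)%:E))%E.
Proof.
case: x => [[x1 x2] x3]; case: th => [[th1 th2] th3] /=.
rewrite /gamma_density /= -/C0.
have [[x10 x20 x30]|npos] := pselect ([/\ 0 < x1, 0 < x2 & 0 < x3]); last first.
  rewrite indicE memNset ?mulr0 ?mul0r//.
  apply/esym; rewrite /series4.
  do 4 (apply: eseries0 => ? _ _); rewrite /density_term /plane_term/=.
  have [x1n|x10] := leP x1 0;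
    first by rewrite (gamma_weight_le0 _ x1n) !mul0r mulr0.
  have [x2n|x20] := leP x2 0.
    by rewrite (gamma_weight_le0 _ x2n) mulr0 !mul0r mulr0.
  have [x3n|x30] := leP x3 0; last by exfalso; exact: npos.
  by rewrite (gamma_weight_le0 _ x3n) mul0r !mulr0.
rewrite indicE mem_set// mulr1.
set K := C0 * expR (q1 * x1 + q2 * x2 + q3 * x3) * (x1 * x2 * x3) `^ (lam - 1).
set E := expR (- _).
have K0 : 0 <= K * E.
  apply: mulr_ge0; rewrite ?expR_ge0//; apply: mulr_ge0; rewrite ?powR_ge0//;
  by rewrite mulr_ge0 ?expR_ge0.
have [x1n x2n x3n] : [/\ 0 <= x1, 0 <= x2 & 0 <= x3] by split; exact: ltW.
have z1 : 0 <= b13 * b23 * (x1 * x2 * x3 ^+ 2).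
  by apply: mulr_ge0; apply: mulr_ge0 => //; [exact: mulr_ge0|exact: exprn_ge0].
have z2 : 0 <= b123 * (x1 * x2 * x3) by do 2![apply: mulr_ge0 => //];
  exact: mulr_ge0.
have z3 : 0 <= b12 * (x1 * x2) by do 2![apply: mulr_ge0 => //].
have z4 : 0 <= b13 * (x1 * x3) + b23 * (x2 * x3).
  by apply: addr_ge0; do 2![apply: mulr_ge0 => //].
rewrite mulrAC EFinM F_II_nneseries// -series4Zl; last first.
  by move=> m1 m2 m3 m4; rewrite lee_fin F_II_term_ge0.
apply: eq_series4 => m1 m2 m3 m4; rewrite -EFinM; congr (_%:E).
rewrite /density_term /plane_term /F_II_term /coef /= -!gamma_weightX.
have gw x : 0 < x -> gamma_weight lam x = x `^ (lam - 1).
  by move=> xp; rewrite /gamma_weight indicE mem_set ?mulr1//= in_itv/= xp.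
rewrite !gw//.
have -> : K * E = C0 * (x1 `^ (lam - 1) * x2 `^ (lam - 1) * x3 `^ (lam - 1)) *
    (expR (- ((th1 - q1) * x1 + (th2 - q2) * x2)) * expR (- ((th3 - q3) * x3))).
  rewrite /K /E -expRD !powRM ?mulr_ge0 ?ltW//.
  rewrite [LHS](_ : _ = C0 * (x1 `^ (lam - 1) * x2 `^ (lam - 1) *
    x3 `^ (lam - 1)) *
    (expR (q1 * x1 + q2 * x2 + q3 * x3) * expR (- (th1 * x1 + th2 * x2 +
      th3 * x3))));
    last by ring.
  by rewrite -expRD; congr (_ * expR _); ring.
have -> : b13 * (x1 * x3) + b23 * (x2 * x3) = (b13 * x1 +
  b23 * x2) * x3 by ring.
rewrite !exprMn -?exprM !mul2n -!addnn !exprD !invfM.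
ring.
Qed.

Notation mu := (@lebesgue_measure R).

Lemma powRND (x a : R) n : 0 < x -> x `^ (- (a + n%:R)) = x `^ (- a) * x ^- n.
Proof.
move=> x0; rewrite opprD powRD; last by rewrite (gt_eqF x0) implybT.
by rewrite powR_invn// ltW.
Qed.

Let A (s3 : R) m1 m2 m3 : R :=
  coef m1 m2 m3 * Gamma_fun lam * (s3 `^ (- lam) * s3 ^- (2 * m1 + m2)).

(** The x3 integral produces [Gamma_fun (lam + k)], which cancels the second Pochhammer symbol. The
    power of [s3] in [m4] is kept apart for [plane_series]. *)
Lemma integral_density_term s1 s2 s3 m1 m2 m3 m4 : 0 < s3 ->
  (\int[lebesgue3]_x (density_term s1 s2 s3 m1 m2 m3 m4 x)%:E =
   (A s3 m1 m2 m3)%:E * ((s3 ^- m4)%:E *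
     \int[mu \x mu]_x (plane_term (lam + (m1 + m2 +
       m3)%:R) s1 s2 b13 b23 m4 x)%:E))%E.
Proof.
move=> s30; rewrite /density_term.
set k := (2 * m1 + m2 + m4)%N; set a := lam + (m1 + m2 + m3)%:R.
have k0 : 0 < lam + k%:R by rewrite ltr_wpDr.
have mg : measurable_fun setT (fun x : measurableTypeR R =>
    gamma_weight (lam + k%:R) x * expR (- (s3 * x))).
  by apply: measurable_weighted_exp => //; exact: measurable_gamma_weight.
have g0 (x : measurableTypeR R) :
  0 <= gamma_weight (lam + k%:R) x * expR (- (s3 * x)).
  by rewrite mulr_ge0 ?expR_ge0// gamma_weight_ge0.
under eq_integral do rewrite EFinM.
rewrite ge0_integralZl//; last 3 first.
- apply/measurable_EFinP; apply: measurable_funM.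
    exact: measurableT_comp (measurable_plane_term _ _ _ _ _ _) measurable_fst.
  exact: measurableT_comp mg measurable_snd.
- by move=> x _; rewrite lee_fin mulr_ge0// plane_term_ge0.
- by rewrite lee_fin divr_ge0// ltW.
rewrite (@integral_lebesgue3_mul _ (plane_term a s1 s2 b13 b23 m4)
  (fun x => gamma_weight (lam + k%:R) x * expR (- (s3 * x)))
  (Gamma_fun (lam + k%:R) * s3 `^ (- (lam + k%:R))))//; last 3 first.
- exact: measurable_plane_term.
- by move=> x; exact: plane_term_ge0.
- exact: gamma_weight_integral.
rewrite (muleC (\int[_]_x _)%E) !muleA -!EFinM; congr (_%:E * _)%E.
have s3n n : s3 ^+ n != 0 by rewrite expf_neq0// gt_eqF.
have pn n : pochhammer lam n != 0 by rewrite gt_eqF.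
rewrite Gamma_funD// powRND// /A /k mul2n -addnn !exprD.
by field; rewrite !s3n !pn.
Qed.

(** After the sum over [m4], two Gamma factors from the plane give the square of the first
    Pochhammer symbol; one copy cancels the denominator and the other is the numerator of the
    negative binomial series. The last hypothesis is its convergence condition. *)
Lemma laplace_gamma_density (th : R * R * R) :
  let s1 := th.1.1 - q1 in let s2 := th.1.2 - q2 in let s3 := th.2 - q3 in
  let t1 := s1 - b13 / s3 in let t2 := s2 - b23 / s3 in
  0 < s3 -> 0 < t1 -> 0 < t2 ->
  b13 * b23 / s3 + b123 + b12 * s3 < t1 * t2 * s3 ->
  (\int[lebesgue3]_x (gamma_density x *
      expR (- (th.1.1 * x.1.1 + th.1.2 * x.1.2 + th.2 * x.2)))%:E =
   ((p123 * (t1 * t2 * s3 - b13 * b23 / s3 - b123 - b12 *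
     s3)) `^ (- lam))%:E)%E.
Proof.
move=> s1 s2 s3 t1 t2 s30 t10 t20 hD.
have D0 : 0 < t1 * t2 * s3 by rewrite !mulr_gt0.
transitivity (\int[lebesgue3]_x series4 (fun m1 m2 m3 m4 =>
    (density_term s1 s2 s3 m1 m2 m3 m4 x)%:E))%E.
  by apply: eq_integral => x _; rewrite gamma_density_series.
rewrite integral_series4; last 2 first.
- by move=> *; apply/measurable_EFinP; exact: measurable_density_term.
- by move=> *; rewrite lee_fin density_term_ge0.
transitivity (\sum_(m1 <oo) \sum_(m2 <oo) \sum_(m3 <oo) ((p123 `^ (- lam))%:E *
   (pochhammer lam (m1 + m2 + m3) / (m1`!%:R * m2`!%:R * m3`!%:R) *
     ((b13 * b23 / s3) ^+ m1 * b123 ^+ m2 * (b12 * s3) ^+ m3) *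
     (t1 * t2 * s3) `^ (- (lam + (m1 + m2 + m3)%:R)))%:E))%E.
  rewrite /series4; apply: eq_eseriesr => m1 _; apply: eq_eseriesr => m2 _.
  apply: eq_eseriesr => m3 _.
  have a0 : 0 < lam + (m1 + m2 + m3)%:R by rewrite ltr_wpDr.
  under eq_eseriesr do rewrite integral_density_term//.
  rewrite nneseriesZl; last first.
    move=> n _; rewrite mule_ge0 ?lee_fin ?invr_ge0 ?exprn_ge0 ?(ltW s30)//.
    by apply: integral_ge0 => x _; rewrite lee_fin plane_term_ge0.
  rewrite plane_series// -!EFinM; congr (_%:E).
  rewrite -/t1 -/t2 Gamma_funD//.
  have T0 : 0 < t1 * t2 by rewrite mulr_gt0.
  rewrite !powRND//.
  rewrite [(t1 * t2 * s3) `^ _]powRM ?mulr_ge0 ?(ltW t10) ?(ltW t20) ?(ltW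
    s30)//.
  rewrite /A /coef /C0 mul2n -addnn !exprMn !exprVn !exprD.
  have s3m m : s3 ^+ m != 0 by rewrite expf_neq0// gt_eqF.
  have t1m m : t1 ^+ m != 0 by rewrite expf_neq0// gt_eqF.
  have t2m m : t2 ^+ m != 0 by rewrite expf_neq0// gt_eqF.
  have pn n : pochhammer lam n != 0 by rewrite gt_eqF.
  have gn : Gamma_fun lam != 0 by rewrite gt_eqF.
  have fn n : n`!%:R != 0 :> R by rewrite pnatr_eq0 -lt0n fact_gt0.
  by field; rewrite !s3m !t2m !t1m !fn pn gn.
have y10 : 0 <= b13 * b23 / s3 by rewrite divr_ge0 ?mulr_ge0 ?(ltW s30).
have y30 : 0 <= b12 * s3 by rewrite mulr_ge0// ltW.
have trip0 m1 m2 m3 : (0 <= (pochhammer lam (m1 + m2 +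
  m3) / (m1`!%:R * m2`!%:R * m3`!%:R) *
     ((b13 * b23 / s3) ^+ m1 * b123 ^+ m2 * (b12 * s3) ^+ m3) *
     (t1 * t2 * s3) `^ (- (lam + (m1 + m2 + m3)%:R)))%:E)%E.
  rewrite lee_fin; apply: mulr_ge0; last exact: powR_ge0.
  apply: mulr_ge0; first by rewrite divr_ge0 ?(ltW (poch0 _))// !mulr_ge0.
  by apply: mulr_ge0; [apply: mulr_ge0|]; exact: exprn_ge0.
transitivity ((p123 `^ (- lam))%:E * \sum_(m1 <oo) \sum_(m2 <oo) \sum_(m3 <oo)
   (pochhammer lam (m1 + m2 + m3) / (m1`!%:R * m2`!%:R * m3`!%:R) *
     ((b13 * b23 / s3) ^+ m1 * b123 ^+ m2 * (b12 * s3) ^+ m3) *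
     (t1 * t2 * s3) `^ (- (lam + (m1 + m2 + m3)%:R)))%:E)%E.
  rewrite -nneseriesZl; last by move=> ? _;
    do 2![apply: nneseries_ge0 => ? _ _].
  apply: eq_eseriesr => m1 _.
  rewrite -nneseriesZl; last by move=> ? _; apply: nneseries_ge0 => ? _ _.
  by apply: eq_eseriesr => m2 _; rewrite -nneseriesZl.
rewrite triple_negative_binomial// -EFinM powRM//; first exact: ltW.
by move: hD; lra.
Qed.

End gamma_density.

Lemma density_probability d (T : measurableType d) (R : realType)
    (mu : {measure set T -> \bar R}) (f : T -> \bar R) :
  measurable_fun setT f -> (forall x, 0 <= f x)%E -> (\int[mu]_x f x = 1)%E ->
  exists P : probability T R, forall A, P A = (\int[mu]_(x in A) f x)%E.
Proof.
move=> mf f0 f1; pose nu A := (\int[mu]_(x in A) f x)%E.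
have nu0 : nu set0 = 0%E by rewrite /nu integral_set0.
have nu_ge0 A : (0 <= nu A)%E by apply: integral_ge0.
have nu_add : semi_sigma_additive nu := @density_sigma_additive _ _ _ mu f mf
  f0.
pose M : {measure set T -> \bar R} :=
  HB.pack nu (isMeasure.Build _ _ _ nu nu0 nu_ge0 nu_add).
have M1 : M setT = 1%E by [].
pose P : probability T R := HB.pack nu (isMeasure.Build _ _ _ nu nu0 nu_ge0
  nu_add)
  (Measure_isProbability.Build _ _ _ M M1).
by exists P.
Qed.

Lemma open_orthant_interior (R : realType) :
  [set th : R * R * R | [/\ 0 < th.1.1, 0 < th.1.2 & 0 < th.2]]° !=set0.
Proof.
exists (1, 1, 1); apply/nbhs_ballP; exists 1 => //= -[[a b] c] [[/= ha hb] hc].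
move: ha hb hc; rewrite /ball/= !ltr_distlC.
by move=> /andP[ha _] /andP[hb _] /andP[hc _]; split=> /=; lra.
Qed.

(** * Existence of the law for every positive exponent *)

Section existence.
Context {R : realType}.
Variables (p1 p2 p3 p12 p13 p23 p123 : R).
Hypotheses (p1_gt0 : 0 < p1) (p2_gt0 : 0 < p2) (p3_gt0 : 0 < p3).
Hypotheses (p12_gt0 : 0 < p12) (p13_gt0 : 0 < p13) (p23_gt0 : 0 < p23).
Hypothesis p123_gt0 : 0 < p123.

Let P := multilinear3 p1 p2 p3 p12 p13 p23 p123.
Let q1 := - (p23 / p123).
Let q2 := - (p13 / p123).
Let q3 := - (p12 / p123).
Let b12 := - (p3 / p123) + p23 * p13 / p123 ^+ 2.
Let b13 := - (p2 / p123) + p23 * p12 / p123 ^+ 2.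
Let b23 := - (p1 / p123) + p13 * p12 / p123 ^+ 2.
Let b123 := - (1 / p123) + p12 * p3 / p123 ^+ 2 + p13 * p2 / p123 ^+ 2
      + p23 * p1 / p123 ^+ 2 - 2 * (p12 * p13 * p23 / p123 ^+ 3).
Hypotheses (b12_ge0 : 0 <= b12) (b13_ge0 : 0 <= b13) (b23_ge0 : 0 <= b23).
Hypothesis b123_ge0 : 0 <= b123.

Lemma gamma_density_laplace (lam a b c : R) : 0 < lam ->
  0 <= a -> 0 <= b -> 0 <= c ->
  (\int[lebesgue3]_x (gamma_density lam p123 q1 q2 q3 b12 b13 b23 b123 x *
     expR (- (a * x.1.1 + b * x.1.2 + c * x.2)))%:E =
   (P (a, b, c) `^ (- lam))%:E)%E.
Proof.
move=> lam0 a0 b0 c0.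
pose s1 := a - q1; pose s2 := b - q2; pose s3 := c - q3.
have s10 : 0 < s1 by rewrite /s1 opprK ltr_wpDl// divr_gt0.
have s20 : 0 < s2 by rewrite /s2 opprK ltr_wpDl// divr_gt0.
have s30 : 0 < s3 by rewrite /s3 opprK ltr_wpDl// divr_gt0.
have PE : P (a, b, c) = p123 * (s1 * s2 * s3 - b23 * s1 - b13 * s2 - b12 *
  s3 - b123).
  rewrite /P /multilinear3 /s1 /s2 /s3 /b12 /b13 /b23 /b123 /q1 /q2 /q3 /=.
  by field; rewrite gt_eqF.
have Pp : 0 < s1 * s2 * s3 - b23 * s1 - b13 * s2 - b12 * s3 - b123.
  rewrite -(pmulr_rgt0 _ p123_gt0) -PE; apply: lt_le_trans ltr01 _.
  exact: multilinear3_ge1.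
have h1 : 0 <= b23 * s1 by rewrite mulr_ge0// ltW.
have h2 : 0 <= b13 * s2 by rewrite mulr_ge0// ltW.
have h3 : 0 <= b12 * s3 by rewrite mulr_ge0// ltW.
(* Multiplied by [s2 * s3], the claim compares [s1 * s2 * s3] with [b13 * s2]; the difference is P /
   p123 plus nonnegative terms. The bound for the second rate is symmetric. *)
have t1 : 0 < s1 - b13 / s3.
  rewrite subr_gt0 ltr_pdivrMr// -(ltr_pM2r s20) -subr_gt0.
  rewrite (_ : _ - _ = (s1 * s2 * s3 - b23 * s1 - b13 * s2 - b12 * s3 - b123) +
    b23 * s1 + b12 * s3 + b123); last by ring.
  by do 3![apply: ltr_wpDr => //].
have t2 : 0 < s2 - b23 / s3.
  rewrite subr_gt0 ltr_pdivrMr// -(ltr_pM2r s10) -subr_gt0.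
  rewrite (_ : _ - _ = (s1 * s2 * s3 - b23 * s1 - b13 * s2 - b12 * s3 - b123) +
    b13 * s2 + b12 * s3 + b123); last by ring.
  by do 3![apply: ltr_wpDr => //].
have DE : (s1 - b13 / s3) * (s2 - b23 / s3) * s3 - b13 *
  b23 / s3 - b123 - b12 * s3 =
    s1 * s2 * s3 - b23 * s1 - b13 * s2 - b12 * s3 - b123.
  by field; rewrite gt_eqF.
have hD : b13 * b23 / s3 + b123 +
  b12 * s3 < (s1 - b13 / s3) * (s2 - b23 / s3) * s3.
  rewrite -subr_gt0 [X in 0 < X](_ : _ =
    (s1 - b13 / s3) * (s2 - b23 / s3) * s3 - b13 * b23 / s3 - b123 - b12 * s3);
    last by ring.
  by rewrite DE.
have := @laplace_gamma_density R lam p123 q1 q2 q3 b12 b13 b23 b123 lam0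
  p123_gt0
  b12_ge0 b13_ge0 b23_ge0 b123_ge0 (a, b, c) s30 t1 t2 hD.
by rewrite /= -/s1 -/s2 -/s3 DE -PE.
Qed.

Lemma gamma_law_exists (lam : R) : 0 < lam ->
  exists gam : probability (mR3 R) R,
    (forall A : set (mR3 R), measurable A -> gam A =
      (\int[lebesgue3]_(x in A)
        (gamma_density lam p123 q1 q2 q3 b12 b13 b23 b123 x)%:E)%E) /\
    (forall a b c, 0 <= a -> 0 <= b -> 0 <= c ->
       laplace3 gam (a, b, c) = (P (a, b, c) `^ (- lam))%:E).
Proof.
move=> lam0; set D := gamma_density _ _ _ _ _ _ _ _ _.
have DE (x : mR3 R) : (D x)%:E = (D x * expR (- (0 * x.1.1 + 0 * x.1.2 +
  0 * x.2)))%:E.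
  by rewrite !mul0r !addr0 oppr0 expR0 mulr1.
have DS (x : mR3 R) : (D x)%:E = series4 (fun m1 m2 m3 m4 =>
    (density_term lam p123 b12 b13 b23 b123 (0 - q1) (0 - q2) (0 - q3) m1 m2
      m3 m4 x)%:E).
  by rewrite DE (gamma_density_series _ _ _ _ _ _ _ _ _ (0, 0, 0)).
have D0 (x : mR3 R) : (0 <= (D x)%:E)%E.
  rewrite DS; apply: series4_ge0 => *; rewrite lee_fin.
  exact: density_term_ge0.
have mD : measurable_fun setT (fun x : mR3 R => (D x)%:E).
  rewrite (_ : (fun x => _) = (fun x : mR3 R => series4 (fun m1 m2 m3 m4 =>
    (density_term lam p123 b12 b13 b23 b123 (0 - q1) (0 - q2) (0 - q3) m1 m2
      m3 m4 x)%:E)));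
    last exact/funext.
  apply: measurable_series4 => [*|*].
    by apply/measurable_EFinP; exact: measurable_density_term.
  by rewrite lee_fin; exact: density_term_ge0.
(* The total mass is the transform at the origin, where [P] equals 1. *)
have D1 : (\int[lebesgue3]_x (D x)%:E = 1)%E.
  under eq_integral do rewrite DE.
  rewrite gamma_density_laplace// (_ : P _ = 1) ?powR1//.
  by rewrite /P /multilinear3 /=; ring.
have [gam gamE] := density_probability mD D0 D1.
exists gam; split=> [A _|a b c a0 b0 c0]; first exact: gamE.
rewrite -gamma_density_laplace//.
rewrite /laplace3 (ge0_integral_density mD D0 (fun A _ => gamE A)).
- by apply: eq_integral => x _; rewrite -EFinM mulrC.
- by apply/measurable_EFinP; exact: measurable_expRN3.
- by move=> x; rewrite lee_fin expR_ge0.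
Qed.

End existence.

Unset Implicit Arguments.

Theorem theorem7 (R : realType) (lam p1 p2 p3 p12 p13 p23 p123 : R) :
  0 < lam ->
  0 < p1 -> 0 < p2 -> 0 < p3 ->
  0 < p12 -> 0 < p13 -> 0 < p23 -> 0 < p123 ->
  let P := fun th : R * R * R =>
    1 + p1 * th.1.1 + p2 * th.1.2 + p3 * th.2
      + p12 * (th.1.1 * th.1.2) + p13 * (th.1.1 * th.2)
      + p23 * (th.1.2 * th.2) + p123 * (th.1.1 * th.1.2 * th.2) in
  let q1 := - (p23 / p123) in
  let q2 := - (p13 / p123) in
  let q3 := - (p12 / p123) in
  let b12 := - (p3 / p123) + p23 * p13 / p123 ^+ 2 in
  let b13 := - (p2 / p123) + p23 * p12 / p123 ^+ 2 in
  let b23 := - (p1 / p123) + p13 * p12 / p123 ^+ 2 in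
  let b123 := - (1 / p123) + p12 * p3 / p123 ^+ 2 + p13 * p2 / p123 ^+ 2
      + p23 * p1 / p123 ^+ 2 - 2 * (p12 * p13 * p23 / p123 ^+ 3) in
  0 <= b12 -> 0 <= b13 -> 0 <= b23 -> 0 <= b123 ->
  let density := fun x : R * R * R =>
    let x1 := x.1.1 in let x2 := x.1.2 in let x3 := x.2 in
    p123 `^ (- lam) / Gamma_fun lam ^+ 3
      * expR (q1 * x1 + q2 * x2 + q3 * x3)
      * (x1 * x2 * x3) `^ (lam - 1)
      * F_II lam lam (b13 * b23 * (x1 * x2 * x3 ^+ 2)) (b123 * (x1 * x2 * x3))
          (b12 * (x1 * x2)) (b13 * (x1 * x3) + b23 * (x2 * x3))
      * \1_[set y : R * R * R | [/\ 0 < y.1.1, 0 < y.1.2 & 0 < y.2]] x in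
  exists gam : probability (mR3 R) R,
    [/\ mgamma_law P lam gam,
        forall nu : probability (mR3 R) R, mgamma_law P lam nu ->
          forall A : set (mR3 R), measurable A -> nu A = gam A,
        infinitely_divisible3 gam &
        forall A : set (mR3 R), measurable A ->
          gam A = (\int[lebesgue3]_(x in A) (density x)%:E)%E].
Proof.
move=> lam0 p1_gt0 p2_gt0 p3_gt0 p12_gt0 p13_gt0 p23_gt0 p123_gt0.
move=> P q1 q2 q3 b12 b13 b23 b123 b12_ge0 b13_ge0 b23_ge0 b123_ge0 density.
have ex (l : R) : 0 < l -> exists gam : probability (mR3 R) R,
    (forall A : set (mR3 R), measurable A -> gam A =
      (\int[lebesgue3]_(x in A)
        (gamma_density l p123 q1 q2 q3 b12 b13 b23 b123 x)%:E)%E) /\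
    (forall a b c, 0 <= a -> 0 <= b -> 0 <= c ->
       laplace3 gam (a, b, c) = (P (a, b, c) `^ (- l))%:E).
  exact: gamma_law_exists.
have P1 (a b c : R) : 0 <= a -> 0 <= b -> 0 <= c -> 1 <= P (a, b, c).
  exact: multilinear3_ge1.
have [gam [gamE gamL]] := ex _ lam0.
pose Th := [set th : R * R * R | [/\ 0 < th.1.1, 0 < th.1.2 & 0 < th.2]].
have ThL th : Th th -> laplace3 gam th = (P th `^ (- lam))%:E.
  by case: th => -[a b] c [/= /ltW a0 /ltW b0 /ltW c0]; exact: gamL.
have ThP : Th `<=` [set th | 0 < P th].
  move=> [[a b] c] [/= /ltW a0 /ltW b0 /ltW c0].
  by apply: lt_le_trans (P1 _ _ _ a0 b0 c0).
exists gam; split.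
- by exists Th; split => //; exact: open_orthant_interior.
- move=> nu nuL A mA.
  have nuE (a b c : R) : 0 <= a -> 0 <= b -> 0 <= c ->
      laplace3 nu (a, b, c) = (P (a, b, c) `^ (- lam))%:E.
    by apply: has_laplace3_orthant => //; exact: probability_setT.
  (* The remaining condition, a transform at most 1 on the orthant, follows from [P >= 1] there. *)
  apply: laplace3_unique => // a b c a0 b0 c0; first by rewrite nuE// gamL.
  rewrite nuE// lee_fin powRN invf_le1.
    by rewrite -(powRr0 (P (a, b, c))) ler_powR ?P1// ltW.
  by apply: powR_gt0; apply: lt_le_trans (P1 _ _ _ a0 b0 c0).
(* The t-th power of P^-lam is P^-(lam t), the transform of the law with exponent [lam * t]. *)
- move=> t t0; have [nu [_ nuL]] := ex _ (mulr_gt0 lam0 t0).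
  exists nu, Th; split; first exact: open_orthant_interior.
    by move=> th /ThL /= ->.
  move=> th Tth; rewrite (ThL _ Tth) /= -powRrM mulNr.
  by case: th Tth => -[a b] c [/= /ltW a0 /ltW b0 /ltW c0]; exact: nuL.
- by move=> A mA; exact: gamE.
Qed.
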